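(* Let $\beta>\alpha\ge 0$ be real numbers. There exist a constant $p_0$ and constants $c,C>0$, all depending only on $\alpha$ and $\beta$, such that for every prime $p\ge p_0$ and every non-principal Dirichlet character $\chi$ modulo $p$, $$ c\,\sqrt p\,\log\log p \;\le\; \max_{0\le\theta<1}\left|F_\chi(\alpha,\beta;\theta)\right| \;\le\; C\,\sqrt p\,\log p , $$ where $F_\chi(\alpha,\beta;\theta)=\sum_{\alpha p<n\le\beta p}\chi(n)e(n\theta)$.
   Context: Here $e(x)=e^{2\pi i x}$ for $x\in\mathbb{R}$, the sum defining $F_\chi(\alpha,\beta;\theta)$ runs over integers $n$ with $\alpha p<n\le \beta p$, and $\theta$ ranges over real numbers in $[0,1)$. *)

(* Defs.v *)
From mathcomp Require Import all_boot all_order all_algebra.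
From mathcomp Require Import all_classical all_reals all_analysis.
From mathcomp Require Import complex.

Set Implicit Arguments.
Unset Strict Implicit.
Unset Printing Implicit Defensive.

Import Order.TTheory GRing.Theory Num.Theory.

Local Open Scope classical_set_scope.
Local Open Scope ring_scope.
Local Open Scope complex_scope.

(* exp (2 pi i x), written with Euler's formula. *)
Definition e (R : realType) (x : R) : R[i] :=
  cos (2 * pi * x) +i* sin (2 * pi * x).

(* [chi 1 = 1] is a consequence of the last two clauses. *)
Definition dirichlet_character (R : realType) (q : nat) (chi : int -> R[i]) :
  Prop :=
  [/\ forall n : int, chi (n + q%:Z) = chi n,
      forall m n : int, chi (m * n) = chi m * chi n
    & forall n : int, chi n != 0 <-> coprimez n q%:Z].

Definition principal_character (R : realType) (q : nat) (n : int) : R[i] :=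
  if coprimez n q%:Z then 1 else 0.

(* The index set is finite, so [fsbig] is the ordinary sum. *)
Definition F (R : realType) (p : nat) (chi : int -> R[i]) (alpha beta theta : R)
  : R[i] :=
  \sum_(n \in [set n : int | alpha * p%:R < n%:~R <= beta * p%:R])
    chi n * e (n%:~R * theta).

Definition is_max (R : realType) (A : set R) (M : R) : Prop :=
  A M /\ ubound A M.

(* Main.v *)
Require Import Defs.
From mathcomp Require Import all_boot all_order all_algebra all_field.
From mathcomp Require Import all_classical all_reals all_analysis.
From mathcomp Require Import complex.
From mathcomp Require Import zify ring lra.

(** Why the theorem is true.

    Write tau for the Gauss sum of the conjugate character; |tau| = sqrt p.
    Expanding chi(n) in additive characters gives
      tau F(x / p) = sum over a mod p of conj chi(a) D((a + x) / p),
    where D(y) is the sum of e(n y) over alpha p < n <= beta p, a geometric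
    sum with |sin (pi y)| |D(y)| = |sin (pi L y)|, L being the number of
    terms ([gauss_tau_Fsum], [dkernel_sin]).  The points (a + x) / p are
    spaced by 1 / p modulo 1, so the sum of the |D| is O(p log p), and the
    upper bound follows ([sum_dkernel], [nm_Fsum_le]).

    For the lower bound, F is averaged over the translates x - k, k mod p,
    with the Riesz product
      R(k) = product over m in S of (1 + eps_m Re chi(k + m)) >= 0,
    where S = {1, ..., M} and eps_m is a sign.  If the values chi(k + m) were
    independent, the average of R(k) would be 1, and that of
    R(k) conj chi(k + m) would be a constant times eps_m for m in S and 0 for
    m outside S.  The average of tau F would then be a constant times the sum
    of eps_m D((m + x) / p) over m in S, and signs can be chosen to make this
    at least half of the sum of the |D| ([sign_choice]).  As
    |D(m / p)| + |D((m + p/(2L)) / p)| is at least of order p / m (one of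
    sine and cosine is large), x = 0 or x = p / (2 L) makes this sum at least
    of order p log M ([sum_dkernel_ge]).  With M about (log p) / 8 this gives
    sqrt p log log p.

    The required near independence is a bound with a power saving for
    sum over k of chi(product over a of (k + a)^(e_a)), with as many as
    M + 1 shifts and chi of arbitrary order ([weil_bound]).  The exponent
    2/3 is enough here, which permits a short proof of this weak form of
    Weil's theorem:
    - the sums over the fields with p^n elements are, up to sign, the power
      sums of the inverse roots of an L-polynomial ([newton_monic_sum],
      [monic_sum_eq0], [newton_unique]);
    - over the field with q = p^n elements, n divisible by 3, the auxiliary
      polynomial method of Stepanov in the form of Bombieri bounds the number
      of x at which the norm of f(x) has a prescribed value by
      q / (p - 1) + O(q^(2/3)) ([stepanov]); counting values of the norm, rather
      than classes of powers, treats characters of all orders at once;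
    - since these counts add up to about q, the upper bounds are also lower
      bounds, so the character sums are O(q^(2/3)) ([frob_sum_bound]);
    - letting n grow, every inverse root has modulus at most p^(2/3)
      ([power_sum_growth]). *)

Set Implicit Arguments.
Unset Strict Implicit.
Unset Printing Implicit Defensive.

Import Order.TTheory GRing.Theory Num.Theory.
Import numFieldNormedType.Exports.

Local Open Scope ring_scope.

(** * Stepanov's auxiliary polynomial *)

Lemma poly_dependence (L : fieldType) (T : finType) (z : T -> {poly L}) (N : nat) :
  (forall t, size (z t) <= N)%N -> (N < #|T|)%N ->
  exists2 b : T -> L, exists t, b t != 0 & \sum_t b t *: z t = 0.
Proof.
move=> szz ltNT.
pose A : 'M[L]_(#|T|, N) := \matrix_(i, k) (z (enum_val i))`_k.
have : kermx A != 0.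
  rewrite -mxrank_eq0 mxrank_ker -lt0n subn_gt0.
  exact: leq_ltn_trans (rank_leq_col A) ltNT.
case/rowV0Pn => v /sub_kermxP vA /rV0Pn[i vi0].
exists (fun t => v 0 (enum_rank t)).
  by exists (enum_val i); rewrite enum_valK.
apply/polyP => k; rewrite coef0 coef_sum.
have [ltkN | leNk] := ltnP k N; last first.
  by rewrite big1 // => t _; rewrite coefZ nth_default ?mulr0 // (leq_trans (szz t)).
move/matrixP: vA => /(_ 0 (Ordinal ltkN)); rewrite !mxE => vA0.
rewrite -[RHS]vA0.
rewrite (reindex (@enum_val T predT)) /=; last by apply: onW_bij; exact: enum_val_bij.
by apply: eq_bigr => j _; rewrite coefZ mxE enum_valK.
Qed.

(** The term of least order at [x0] cannot be cancelled: after division by the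
    corresponding power of [Y] it is the only one that survives at [x0]. *)
Lemma sum_valuations_neq0 (L : fieldType) (T : finType) (b : T -> L) (Y : {poly L})
    (x0 : L) (v : T -> nat) (g : T -> {poly L}) (t : T) :
  Y.[x0] = 0 -> Y != 0 -> injective v -> (forall t, (g t).[x0] != 0) -> b t != 0 ->
  \sum_t b t *: (Y ^+ v t * g t) != 0.
Proof.
move=> Y0 Yn0 vI g0 bt.
case: (@arg_minnP _ t (fun u => b u != 0) v bt) => t0 bt0 mint0.
apply/eqP => sum0.
have : Y ^+ v t0 * (\sum_(t | b t != 0) b t *: (Y ^+ (v t - v t0) * g t)) = 0.
  rewrite -[RHS]sum0 mulr_sumr [RHS](bigID (fun t => b t != 0)) /= [X in _ + X]big1 ?addr0.
    apply: eq_bigr => u bu; rewrite -scalerAr mulrA -exprD subnKC //.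
    exact: mint0.
  by move=> u /negPn /eqP ->; rewrite scale0r.
move/eqP; rewrite mulf_eq0 expf_eq0 (negPf Yn0) andbF /= => /eqP /(congr1 (horner^~ x0)).
rewrite horner0 horner_sum (bigD1 t0) //= big1 ?addr0.
  rewrite subnn expr0 mul1r hornerZ => /eqP.
  by rewrite mulf_eq0 (negPf bt0) (negPf (g0 _)).
move=> u /andP[bu neu]; rewrite hornerZ hornerM horner_exp Y0 expr0n.
have -> : (v u - v t0 == 0)%N = false; last by rewrite mul0r mulr0.
apply/negbTE; rewrite subn_eq0 -ltnNge ltn_neqAle mint0 // andbT.
by apply/eqP => /vI /eqP; rewrite eq_sym (negPf neu).
Qed.

Lemma expf_pchar_sum (L : fieldType) (p m : nat) (T : finType) (F : T -> L) :
  p \in [pchar L] -> (\sum_t F t) ^+ (p ^ m) = \sum_t F t ^+ (p ^ m).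
Proof.
move=> pL; elim: m F => [|m IH] F; first by rewrite expn0 expr1; apply: eq_bigr.
rewrite expnSr exprM IH -(pFrobenius_autE pL) rmorph_sum /=.
by apply: eq_bigr => t _; rewrite pFrobenius_autE -exprM.
Qed.

Lemma closed_root_exists (L : closedFieldType) (n : nat) (b : L) :
  (0 < n)%N -> exists b', b' ^+ n = b.
Proof.
move=> n0; have [x xn] := @solve_monicpoly L n (fun i => if i == 0%N then b else 0) n0.
exists x; rewrite {}xn; case: n n0 => // n _; rewrite big_ord_recl /= expr0 mulr1 big1 ?addr0 //.
by move=> i _; rewrite mul0r.
Qed.

(** Multiplied by [d], the exponent is [Q * (i * E + d * j) + (d * l - i * E)]
    with [Q = d * v + 1], and two values of the second summand differ by less
    than [Q].  So [i * E + d * j] is determined; as [E] is prime to [d]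
    this determines [i], hence [j], hence [l]. *)
Lemma valuation_inj (d w D E v : nat) : (0 < d)%N -> coprime E d ->
   (d * (w * D) + d * E < d * v)%N ->
  injective (fun t : 'I_d * 'I_w.+1 * 'I_(w * D).+1 =>
      (t.1.1 * v * E + (t.1.2 * (d * v).+1 + t.2))%N).
Proof.
move=> d0 coE ltv [[i j] l] [[i' j'] l'] /= eqv.
have ltl := ltn_ord l; have ltl' := ltn_ord l'.
have lti := ltn_ord i; have lti' := ltn_ord i'.
set Q := (d * v).+1 in eqv.
have e1 : (Q * (i * E + d * j) + d * l + i' * E =
           Q * (i' * E + d * j') + d * l' + i * E)%N.
  have e2 : (d * (i * v * E + (j * Q + l)) = d * (i' * v * E + (j' * Q + l')))%N.
    by rewrite eqv.
  rewrite /Q in e2 *; nia.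
have eqn : (i * E + d * j = i' * E + d * j')%N.
  have b1 : (d * l <= d * (w * D))%N by rewrite leq_mul2l -ltnS ltl orbT.
  have b1' : (d * l' <= d * (w * D))%N by rewrite leq_mul2l -ltnS ltl' orbT.
  have b2 : (i * E <= d * E)%N by rewrite leq_mul2r ltnW ?orbT.
  have b2' : (i' * E <= d * E)%N by rewrite leq_mul2r ltnW ?orbT.
  have b3 : (d * (w * D) + d * E < Q)%N by rewrite /Q; lia.
  move: e1 b1 b1' b2 b2' b3; clear.
  move: (i * E + d * j)%N (i' * E + d * j')%N (d * l)%N (d * l')%N (i * E)%N (i' * E)%N
     (d * (w * D))%N (d * E)%N => a a' b b' c c' B1 B2.
  clearbody Q => e1 *.
  have [lt|lt|//] := ltngtP a a'; nia.
have eqi : i = i' :> nat.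
  have : (i * E = i' * E %[mod d])%N.
    have /= := congr1 (modn^~ d) eqn.
    by rewrite ![(_ + d * _)%N]addnC !(mulnC d) !modnMDl.
  wlog lei : i i' {eqn e1 eqv lti lti'} / (i <= i')%N.
    by move=> wlog_i; case: (leqP i i') => [/wlog_i //|/ltnW /wlog_i H eq];
       apply/esym/H.
  move/esym/eqP; rewrite eqn_mod_dvd ?leq_mul2r ?lei ?orbT // -mulnBl.
  rewrite Gauss_dvdl 1?coprime_sym // => /dvdn_leq.
  have := ltn_ord i'; lia.
have eqj : j = j' :> nat by move: eqn; rewrite eqi; nia.
have eql : l = l' :> nat by move: eqv; rewrite eqi eqj; lia.
by congr (_, _, _); apply: val_inj.
Qed.

Lemma size_exp_le (L : fieldType) (f : {poly L}) (D n : nat) :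
  (size f <= D.+1)%N -> (size (f ^+ n) <= (n * D).+1)%N.
Proof.
move=> szf; apply: leq_trans (size_poly_exp_leq _ _) _; rewrite ltnS mulnC leq_mul2l.
by apply/orP; right; lia.
Qed.

Lemma size_mul_le (L : fieldType) (f g : {poly L}) (m n : nat) :
  (size f <= m.+1)%N -> (size g <= n.+1)%N -> (size (f * g)%R <= (m + n).+1)%N.
Proof. by move=> hf hg; apply: leq_trans (size_polyMleq _ _) _; lia. Qed.

(** Here [P = d * w + 1] is a power of the characteristic, [Q = d * v + 1] and
    [q = P * Q], so that [v * P + w = (q - 1) / d]: if [x0] lies in the field
    with [q] elements then so do the points of [s], and [f ^ ((q - 1) / d)]
    takes the value [c] there.  The count is [q / d] up to a multiple of [P + Q].

    With [Y = 'X - x0], consider [R], the sum over [i < d], [j <= w],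
    [l <= w * D] of [b' i j l *: Y ^ (l + j Q) * f ^ (i v)].  At a point of
    [s] one has [Y ^ (P Q) = Y] and [f ^ (v P + w) = c], so
    [R ^ P * f ^ ((d - 1) w)] takes the same value as a polynomial of low
    degree in which the [b' ^ P] are the coefficients of a linear
    combination.  There are more unknowns than conditions, so the [b'] can be
    chosen, not all zero, such that this polynomial vanishes identically.
    Then [R ^ P] vanishes on [s], hence so does [R], whose degree is only about
    [q / d].  Finally [R != 0], because its terms have pairwise distinct
    orders at [x0]. *)
Lemma stepanov (L : closedFieldType) (p m d w v E D : nat) (f f1 : {poly L})
    (x0 c : L) (s : seq L) :
  p \in [pchar L] -> (p ^ m = (d * w).+1)%N -> (1 < d)%N -> coprime E d ->
  f = ('X - x0%:P) ^+ E * f1 -> f1.[x0] != 0 -> (size f <= D.+1)%N ->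
  (d * (w * D) + d * E < d * v)%N -> c != 0 -> uniq s ->
  {in s, forall x, (x - x0) ^+ ((d * w).+1 * (d * v).+1) = x - x0} ->
  {in s, forall x, f.[x] ^+ (v * (d * w).+1 + w) = c} ->
  (size s <= w * (d * v).+1 + w * D + d * v * D)%N.
Proof.
move=> pL PE d1 coE fE f10 szf ltv c0 us sq sc.
set P := (d * w).+1 in PE sq sc *; set Q := (d * v).+1 in sq *.
pose T := ('I_d * 'I_w.+1 * 'I_(w * D).+1)%type.
pose Y : {poly L} := 'X - x0%:P.
have szY : (size Y <= 2)%N by rewrite size_XsubC.
pose z (t : T) : {poly L} := c ^+ t.1.1 *: (Y ^+ (t.2 * P + t.1.2) * f ^+ ((d.-1 - t.1.1) * w)).
(* [N] bounds the size of the polynomial that replaces [R ^ P]: the degree of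
   [f] enters through the exponents [(d - 1 - i) * w] left over once
   [f ^ (v P + w) = c] has been used. *)
pose N := (w * D * P + w + d.-1 * w * D).+1.
have szz t : (size (z t) <= N)%N.
  apply: leq_trans (size_scale_leq _ _) _.
  apply: leq_trans (size_mul_le (size_exp_le _ szY) (size_exp_le _ szf)) _.
  rewrite /N ltnS muln1 leq_add // ?leq_add //; last by rewrite !leq_mul ?leq_subr.
    by rewrite leq_mul2r -ltnS ltn_ord orbT.
  by rewrite -ltnS ltn_ord.
have [|b [t0 bt0] bz] := @poly_dependence L T z N szz.
  rewrite !card_prod !card_ord /N /P; case: d d1 {coE ltv PE sq sc P Q T z N szz} => // d d1 /=.
  nia.
have P0 : (0 < P)%N by [].
have [b' b'P] := fin_all_exists (fun t => closed_root_exists (b t) P0).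
pose R := \sum_t b' t *: (Y ^+ (t.1.1 * v * E + (t.1.2 * Q + t.2)) * f1 ^+ (t.1.1 * v)).
have Rn0 : R != 0.
  apply: (@sum_valuations_neq0 _ _ _ _ x0 _ _ t0).
  - by rewrite !hornerE subrr.
  - by rewrite polyXsubC_eq0.
  - by apply: valuation_inj => //; apply: ltnW.
  - by move=> t; rewrite horner_exp expf_neq0.
  - by apply: contraNneq bt0 => b0; rewrite -b'P b0 expr0n.
(* The two forms of [R]: orders at [x0] are visible in the first, the action of
   the Frobenius map in the second. *)
have RE : R = \sum_t b' t *: (Y ^+ (t.1.2 * Q + t.2) * f ^+ (t.1.1 * v)).
  apply: eq_bigr => t _; congr (_ *: _).
  by rewrite fE exprMn -exprM mulrA -exprD addnC [(E * _)%N]mulnC.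
have R0 x : x \in s -> R.[x] = 0.
  move=> xs; have fx := sc x xs.
  have fx0 : f.[x] != 0.
    by apply: contraNneq c0 => fx0; rewrite -fx fx0 expr0n; case: (v) (ltv) => //; lia.
  suff : R.[x] ^+ P * f.[x] ^+ (d.-1 * w) = 0.
    by move/eqP; rewrite mulf_eq0 !expf_eq0 (negPf fx0) !andbF orbF /= => /eqP.
  rewrite -[RHS](horner0 x) -bz RE !horner_sum -PE (expf_pchar_sum _ _ pL) PE mulr_suml.
  apply: eq_bigr => t _.
  rewrite !hornerZ exprMn b'P -mulrA; congr (_ * _).
  rewrite !(hornerM, horner_exp) hornerXsubC exprMn -!exprM mulrCA -mulrA.
  have -> : (x - x0) ^+ ((t.1.2 * Q + t.2) * P) = (x - x0) ^+ (t.2 * P + t.1.2).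
    rewrite mulnDl exprD [RHS]exprD mulrC; congr (_ * _).
    by rewrite -mulnA [(Q * P)%N]mulnC mulnC exprM sq.
  congr (_ * _); rewrite -fx -exprM -!exprD; congr (_ ^+ _).
  have := ltn_ord t.1.1; move: (nat_of_ord t.1.1) => i lti.
  rewrite mulnBl.
  have : (i * w <= d.-1 * w)%N by rewrite leq_mul2r; lia.
  nia.
have lt : (size s < size R)%N.
  by apply: max_poly_roots => //; apply/allP => x xs; rewrite rootE R0.
rewrite -ltnS; apply: leq_trans lt _.
rewrite RE; apply: leq_trans (size_sum _ _ _) _; apply/bigmax_leqP => t _.
apply: leq_trans (size_scale_leq _ _) _.
apply: leq_trans (size_mul_le (size_exp_le _ szY) (size_exp_le _ szf)) _.
rewrite ltnS muln1 leq_add //.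
  by rewrite leq_add ?leq_mul // -ltnS ltn_ord.
by rewrite !leq_mul // ltnW.
Qed.

(** * Frobenius orbits and the Newton identity of an L-polynomial *)

Section Closure.
Variables (p : nat) (L : closedFieldType) (phi : {rmorphism 'F_p -> L}).
Hypothesis p_pr : prime p.

Lemma pchar_closure : p \in [pchar L].
Proof. by rewrite (fmorph_pchar phi) pchar_Fp. Qed.
Let pL := pchar_closure.

Lemma Xpn_subX_sub (n : nat) (x y : L) : (x - y) ^+ (p ^ n) = x ^+ (p ^ n) - y ^+ (p ^ n).
Proof.
elim: n x y => [|n IH] x y; first by rewrite expn0 !expr1.
by rewrite expnSr !exprM IH -!(pFrobenius_autE pL) pFrobenius_autB_comm //; apply: mulrC.
Qed.

Lemma expr_pn_inj (n : nat) : injective (fun x : L => x ^+ (p ^ n)).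
Proof.
move=> x y /= /eqP; rewrite -subr_eq0 -Xpn_subX_sub expf_eq0 subr_eq0.
by case/andP => _ /eqP.
Qed.

(** The field with [p ^ n] elements inside the algebraic closure, as the list
    of roots of ['X ^ (p ^ n) - 'X]. *)
Definition Fq (n : nat) : seq L := sval (closed_field_poly_normal ('X^(p ^ n) - 'X : {poly L})).

Lemma Fq_prod n : (0 < n)%N -> 'X^(p ^ n) - 'X = \prod_(z <- Fq n) ('X - z%:P).
Proof.
move=> n0; rewrite /Fq; case: closed_field_poly_normal => r /= {1}->.
have p1 : (1 < p ^ n)%N by rewrite -{1}(exp1n n) ltn_exp2r // prime_gt1.
by rewrite lead_coefDl ?lead_coefXn ?scale1r // size_polyN size_polyX size_polyXn.
Qed.

Lemma mem_Fq n x : (0 < n)%N -> (x \in Fq n) = (x ^+ (p ^ n) == x).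
Proof.
move=> n0; rewrite -root_prod_XsubC -Fq_prod // rootE !hornerE.
by rewrite subr_eq0.
Qed.

Lemma uniq_Fq n : (0 < n)%N -> uniq (Fq n).
Proof.
move=> n0; rewrite -separable_prod_XsubC -Fq_prod // unlock.
have q0 : ((p ^ n)%N%:R : {poly L}) = 0.
  by apply/eqP; rewrite -(dvdn_pcharf (etrans (pchar_poly _ _) pL)) dvdn_exp.
rewrite derivB derivXn derivX -mulr_natr q0 mulr0 sub0r.
by rewrite -[X in coprimep _ (- X)]scale1r -scaleNr coprimepZr ?coprimep1 // oppr_eq0 oner_eq0.
Qed.

Lemma size_Fq n : (0 < n)%N -> size (Fq n) = (p ^ n)%N.
Proof.
move=> n0; have := congr1 (fun q : {poly L} => size q) (Fq_prod n0).
have p1 : (1 < p ^ n)%N by rewrite -{1}(exp1n n) ltn_exp2r // prime_gt1.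
rewrite /= size_polyDl ?size_polyXn ?size_polyN ?size_polyX //.
by rewrite size_prod_XsubC => -[].
Qed.

(** The equation [y ^ p = y] has at most [p] roots, and the prime field
    already provides [p] of them. *)
Lemma Fp_imageP (y : L) : y ^+ p = y -> exists a, phi a = y.
Proof.
move=> yp; have y1 : y \in Fq 1 by rewrite mem_Fq // expn1 yp.
have ui : uniq [seq phi a | a : 'F_p].
  by rewrite map_inj_uniq ?enum_uniq //; apply: fmorph_inj.
have [||_ imE] := @uniq_min_size _ _ (Fq 1) ui.
- move=> _ /mapP[a _ ->]; rewrite mem_Fq // expn1 -rmorphXn.
  by have := expf_card a; rewrite card_Fp // => ->.
- by rewrite size_Fq // expn1 size_map -cardE card_Fp.
by move: y1; rewrite -imE => /mapP[a _ ->]; exists a.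
Qed.

(** Partial inverse of the embedding of the prime field; it is meaningful on
    fixed points of the Frobenius map and has the junk value [0] elsewhere. *)
Definition to_Fp (y : L) : 'F_p := odflt 0 [pick a | phi a == y].

Lemma to_FpK y : y ^+ p = y -> phi (to_Fp y) = y.
Proof.
case/Fp_imageP => a ay; rewrite /to_Fp; case: pickP => [b /eqP //|/(_ a)].
by rewrite ay eqxx.
Qed.

Lemma to_Fp0 : to_Fp 0 = 0.
Proof.
apply: (fmorph_inj phi); rewrite to_FpK ?rmorph0 // expr0n.
by rewrite gtn_eqF // prime_gt0.
Qed.

(** The characteristic polynomial over the prime field of an element of the
    field with [p ^ n] elements. *)
Definition orbit_poly n (x : L) : {poly L} := \prod_(j < n) ('X - (x ^+ (p ^ j))%:P).
Definition orbit_polyFp n x : {poly 'F_p} := map_poly to_Fp (orbit_poly n x).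

Lemma orbit_poly_monic n x : orbit_poly n x \is monic.
Proof. by rewrite /orbit_poly; apply: monic_prod => j _; apply: monicXsubC. Qed.

Lemma size_orbit_poly n x : size (orbit_poly n x) = n.+1.
Proof.
rewrite /orbit_poly -(big_mkord xpredT (fun j => 'X - (x ^+ (p ^ j))%:P)).
by rewrite size_prod_XsubC size_iota subn0.
Qed.

(** Raising the coefficients to the power [p] permutes the factors
    cyclically. *)
Lemma orbit_poly_fixed n x i : (0 < n)%N -> x \in Fq n ->
  (orbit_poly n x)`_i ^+ p = (orbit_poly n x)`_i.
Proof.
move=> n0; rewrite mem_Fq // => /eqP xq.
suff E : map_poly (pFrobenius_aut pL) (orbit_poly n x) = orbit_poly n x by rewrite -[in RHS]E
  coef_map.
rewrite /orbit_poly rmorph_prod; case: n n0 xq => // n _ xq.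
rewrite [RHS]big_ord_recl big_ord_recr /= mulrC; congr (_ * _).
  by rewrite rmorphB /= map_polyX map_polyC /= pFrobenius_autE -exprM -expnSr xq expn0 expr1.
apply: eq_bigr => j _; rewrite rmorphB /= map_polyX map_polyC /= pFrobenius_autE.
by rewrite -exprM -expnSr.
Qed.

Lemma map_orbit_polyFp n x : (0 < n)%N -> x \in Fq n ->
  map_poly phi (orbit_polyFp n x) = orbit_poly n x.
Proof.
move=> n0 xn; apply/polyP => i.
by rewrite coef_map /= /orbit_polyFp [X in phi X]coef_map_id0 ?to_Fp0 // to_FpK //
  orbit_poly_fixed.
Qed.

(** The exponents [i] with [x ^ (p ^ i) = x] are the multiples of the least
    positive one, which is the degree of [x] over the prime field. *)
Lemma frob_order n0 x : (0 < n0)%N -> x \in Fq n0 ->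
  exists d, [/\ (0 < d)%N, x ^+ (p ^ d) = x &
    forall i, (x ^+ (p ^ i) == x) = (d %| i)%N].
Proof.
move=> n00; rewrite mem_Fq // => xn0.
have ex : exists i, (0 < i)%N && (x ^+ (p ^ i) == x) by exists n0; rewrite n00.
case: (ex_minnP ex) => d /andP[d0 /eqP xd] mind; exists d; split=> // i.
have mulk k : x ^+ (p ^ (k * d)) = x.
  by elim: k => [|k IH]; rewrite ?mul0n ?expn0 ?expr1 // mulSn expnD exprM xd.
apply/idP/idP => [xi|/dvdnP[k ->]]; last by rewrite mulk.
rewrite /dvdn; apply: contraTT (ltn_pmod i d0) => r0; rewrite -leqNgt.
apply: mind; rewrite lt0n r0 /=.
by move: xi; rewrite {1}(divn_eq i d) expnD exprM mulk.
Qed.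

Lemma orbit_poly_mul d k x : x ^+ (p ^ d) = x -> orbit_poly (k * d) x = orbit_poly d x ^+ k.
Proof.
move=> xd; rewrite /orbit_poly; elim: k => [|k IH]; first by rewrite mul0n big_ord0 expr0.
rewrite exprS -IH -!(big_mkord xpredT (fun j => 'X - (x ^+ (p ^ j))%:P)) mulSn.
rewrite (@big_cat_nat _ _ _ d) ?leq_addr //=; congr (_ * _).
rewrite -{1}[d]add0n big_addn addKn; apply: eq_bigr => j _.
by rewrite addnC expnD exprM xd.
Qed.

Lemma conj_root (G : {poly 'F_p}) x j :
  root (map_poly phi G) x -> root (map_poly phi G) (x ^+ (p ^ j)).
Proof.
move=> rx; elim: j => [|j IH]; first by rewrite expn0 expr1.
rewrite expnSr exprM; move: (x ^+ _) IH => {rx}x /eqP rx.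
apply/eqP; rewrite -(pFrobenius_autE pL).
have -> : map_poly phi G = map_poly (pFrobenius_aut pL) (map_poly phi G).
  apply/polyP => i; rewrite !coef_map /= pFrobenius_autE -rmorphXn.
  by have := expf_card G`_i; rewrite card_Fp // => ->.
by rewrite horner_map rx rmorph0.
Qed.

Definition conjugates d (x : L) := [seq x ^+ (p ^ j) | j <- iota 0 d].

Lemma orbit_poly_conjugates d x : orbit_poly d x = \prod_(z <- conjugates d x) ('X - z%:P).
Proof.
by rewrite /orbit_poly /conjugates big_map -(big_mkord xpredT (fun j => 'X - (x ^+ (p ^
  j))%:P)) /index_iota subn0.
Qed.

Lemma expr_pn_collide (i j : nat) (x : L) :
  (i <= j)%N -> x ^+ (p ^ i) = x ^+ (p ^ j) -> x ^+ (p ^ (j - i)) = x.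
Proof.
move=> ij eqx; apply: (@expr_pn_inj i); rewrite -exprM -expnD.
by rewrite subnK // eqx.
Qed.

Lemma uniq_conjugates d (x : L) :
  (forall i, (x ^+ (p ^ i) == x) = (d %| i)%N) -> uniq (conjugates d x).
Proof.
move=> hd; rewrite map_inj_in_uniq ?iota_uniq // => i j.
rewrite !mem_iota !add0n /= => id jd.
wlog ij : i j id jd / (i <= j)%N.
  by move=> wlog_ij; case: (leqP i j) => [/wlog_ij|/ltnW /wlog_ij H /esym /H]; [apply|move=> ->].
move/(expr_pn_collide ij)/eqP; rewrite hd => /dvdn_leq; lia.
Qed.

(** All Frobenius conjugates of a root are roots, so two of the first [n + 1]
    conjugates coincide. *)
Lemma root_pigeonhole (G : {poly 'F_p}) n x : G != 0 -> (size G <= n.+1)%N ->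
  root (map_poly phi G) x -> exists2 i, (0 < i <= n)%N & x ^+ (p ^ i) = x.
Proof.
move=> G0 szG rx.
have : ~~ uniq (conjugates n.+1 x).
  apply: contraL szG => u; rewrite -ltnNge -(size_map_poly phi).
  have <- : size (conjugates n.+1 x) = n.+1 by rewrite size_map size_iota.
  apply: max_poly_roots => //; first by rewrite map_poly_eq0.
  by apply/allP => _ /mapP[j _ ->]; apply: conj_root.
case/(uniqPn 0) => i [j]; rewrite size_map size_iota => -[ij jn].
rewrite !(nth_map 0%N) ?size_iota ?(ltn_trans ij) // !nth_iota ?(ltn_trans ij) // !add0n.
by move/(expr_pn_collide (ltnW ij)) => E; exists (j - i)%N => //; lia.
Qed.

Lemma orbit_polyFp_monic n x : (0 < n)%N -> x \in Fq n -> orbit_polyFp n x \is monic.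
Proof. by move=> n0 xn; rewrite -(map_monic phi) map_orbit_polyFp ?orbit_poly_monic. Qed.

Lemma size_orbit_polyFp n x : (0 < n)%N -> x \in Fq n -> size (orbit_polyFp n x) = n.+1.
Proof. by move=> n0 xn; rewrite -(size_map_poly phi) map_orbit_polyFp ?size_orbit_poly. Qed.

Lemma orbit_polyFp_mul d k x : (0 < d)%N -> (0 < k)%N -> x ^+ (p ^ d) = x ->
  orbit_polyFp (k * d) x = orbit_polyFp d x ^+ k.
Proof.
move=> d0 k0 xd; have xd' : x \in Fq d by rewrite mem_Fq // xd.
have kd0 : (0 < k * d)%N by rewrite muln_gt0 k0.
apply: (map_poly_inj phi); rewrite rmorphXn /= !map_orbit_polyFp ?orbit_poly_mul //.
rewrite mem_Fq //; elim: k {k0 kd0} => [|k IH]; rewrite ?mul0n ?expn0 ?expr1 //.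
by rewrite mulSn expnD exprM xd.
Qed.

(** When [d] is the degree of [x], the polynomial [orbit_polyFp d x] is the
    minimal polynomial of [x] and has [x] as a simple root, so its
    multiplicity in [G] is that of [x] as a root of [G]. *)
Lemma dvd_orbit_polyFp_pow (G : {poly 'F_p}) d x k :
  (0 < d)%N -> (forall i, (x ^+ (p ^ i) == x) = (d %| i)%N) -> G != 0 ->
  (orbit_polyFp d x ^+ k %| G) = (k <= mup x (map_poly phi G))%N.
Proof.
move=> d0 hd; have xd : x ^+ (p ^ d) = x by apply/eqP; rewrite hd.
have xF : x \in Fq d by rewrite mem_Fq // xd.
have xc : x \in conjugates d x by apply/mapP; exists 0%N; rewrite ?mem_iota ?expn0 ?expr1.
have g0 : orbit_polyFp d x != 0 by rewrite monic_neq0 // orbit_polyFp_monic.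
have rdvd (H : {poly 'F_p}) : (orbit_polyFp d x %| H) = root (map_poly phi H) x.
  rewrite -(dvdp_map phi) map_orbit_polyFp // orbit_poly_conjugates; apply/idP/idP => [|rx].
    by rewrite -dvdp_XsubCl; apply: dvdp_trans; rewrite dvdp_XsubCl root_prod_XsubC.
  apply: uniq_roots_dvdp; last by rewrite uniq_rootsE uniq_conjugates.
  by apply/allP => _ /mapP[j _ ->]; apply: conj_root.
elim: k G => [|k IH] G G0; first by rewrite expr0 dvd1p.
have [rx|nrx] := boolP (root (map_poly phi G) x); last first.
  rewrite mupNroot // ltn0; apply: contraNF nrx; rewrite -rdvd.
  by apply: dvdp_trans; rewrite exprS dvdp_mulr.
move: (rx); rewrite -rdvd => /dvdpP[H HE].
have H0 : H != 0 by apply: contraNneq G0; rewrite HE => ->; rewrite mul0r.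
rewrite HE exprSr dvdp_mul2r // IH // rmorphM /= mupM ?map_poly_eq0 //.
rewrite map_orbit_polyFp // orbit_poly_conjugates mu_prod_XsubC count_uniq_mem
  ?uniq_conjugates // xc.
by rewrite addn1 ltnS.
Qed.

(** For a root [x] of degree [d] and multiplicity [v], the degrees [i] that
    count are [d, 2 d, ..., v d]. *)
Lemma sum_orbit_dvd_mup (G : {poly 'F_p}) n x : G != 0 -> size G = n.+1 ->
  (\sum_(1 <= i < n.+1) ((x \in Fq i) && (orbit_polyFp i x %| G)%R) = mup x (map_poly phi G)%R)%N.
Proof.
move=> G0 szG.
have [rx|nrx] := boolP (root (map_poly phi G) x); last first.
  rewrite mupNroot // big_nat big1 // => i /andP[i0 _].
  case: (boolP (x \in Fq i)) => //= xi; apply/eqP; rewrite eqb0.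
  apply: contra nrx; rewrite -(dvdp_map phi) map_orbit_polyFp // -dvdp_XsubCl; apply: dvdp_trans.
  rewrite /orbit_poly; case: i i0 xi => // i _ _.
  by rewrite big_ord_recl /= expn0 expr1 dvdp_mulr.
have [i0 /andP[i00 i0n] xi0] := root_pigeonhole G0 (eq_leq szG) rx.
have [|d [d0 xd hd]] := @frob_order i0 x i00; first by rewrite mem_Fq // xi0.
set v := mup x _.
have vdn : (v * d <= n)%N.
  have : orbit_polyFp d x ^+ v %| G by rewrite dvd_orbit_polyFp_pow.
  move/(dvdp_leq G0); rewrite szG.
  by have := size_exp (orbit_polyFp d x) v; rewrite size_orbit_polyFp ?mem_Fq ?xd //= mulnC
    => <-; rewrite -subn1 leq_subLR add1n.
transitivity (\sum_(1 <= i < n.+1) ((d %| i) && (i <= v * d)))%N.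
  rewrite !big_nat; apply: eq_bigr => i /andP[i1 _]; congr nat_of_bool.
  rewrite mem_Fq // hd; case: (boolP (d %| i)%N) => //= /dvdnP[k ik].
  have k0 : (0 < k)%N by move: i1; rewrite ik; case: (k).
  by rewrite ik orbit_polyFp_mul // dvd_orbit_polyFp_pow // leq_pmul2r.
rewrite (@big_cat_nat _ _ _ (v * d).+1) //= [X in (_ + X)%N]big_nat [X in (_ + X)%N]big1 ?addn0.
  rewrite -[RHS](mulnK v d0) divn_count_dvd; apply: eq_big_nat => i /andP[_].
  by rewrite ltnS => ->; rewrite andbT.
by move=> i /andP[h _]; rewrite leqNgt h andbF.
Qed.

(** This is the identity [deg G = sum of Lambda(g) over the divisors g of G]
    for the von Mangoldt function of polynomials: [Lambda(g)] is the number
    of [x] whose characteristic polynomial is [g]. *)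
Lemma sum_orbit_dvd (G : {poly 'F_p}) n : G \is monic -> size G = n.+1 ->
  (\sum_(1 <= i < n.+1) \sum_(x <- Fq i) (orbit_polyFp i x %| G)%R = n)%N.
Proof.
move=> mG szG; have G0 := monic_neq0 mG.
have [rs rsE] := closed_field_poly_normal (map_poly phi G).
rewrite lead_coef_map (monicP mG) rmorph1 scale1r in rsE.
have szrs : size rs = n.
  by have := size_map_poly phi G; rewrite rsE szG size_prod_XsubC => -[].
rewrite -[RHS]szrs -sum1_size -[RHS]big_undup_iterop_count /=.
transitivity (\sum_(x <- undup rs) \sum_(1 <= i < n.+1) ((x \in Fq i) && (orbit_polyFp i x %|
  G)%R))%N; last first.
  apply: eq_bigr => x _; rewrite sum_orbit_dvd_mup // rsE mu_prod_XsubC Monoid.iteropE.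
  by rewrite iter_addn_0 mul1n.
rewrite exchange_big /= !big_nat; apply: eq_bigr => i /andP[i0 _].
rewrite [RHS](eq_bigr (fun x => if x \in Fq i then ((orbit_polyFp i x %| G)%R : nat) else
  0%N)); last first.
  by move=> x _; case: (x \in Fq i).
rewrite -[RHS]big_mkcond /= -[RHS]big_filter.
rewrite (bigID (mem (undup rs))) /= [X in (_ + X)%N]big1_seq ?addn0.
  rewrite -big_filter; apply: perm_big; apply: uniq_perm.
  - by rewrite filter_uniq // uniq_Fq.
  - by rewrite filter_uniq // undup_uniq.
  by move=> x; rewrite !mem_filter andbC.
move=> x /andP[xrs xi]; apply/eqP; rewrite eqb0; apply: contra xrs => dv.
have xF : x \in Fq i by [].
rewrite mem_undup -root_prod_XsubC -rsE -dvdp_XsubCl.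
rewrite -(dvdp_map phi) map_orbit_polyFp // in dv; apply: dvdp_trans dv.
rewrite /orbit_poly; case: i i0 {xi xF} => // i _.
by rewrite big_ord_recl /= expn0 expr1 dvdp_mulr.
Qed.

Definition monic_of n (v : 'rV['F_p]_n) : {poly 'F_p} := 'X^n + rVpoly v.

Lemma size_monic_of n v : size (@monic_of n v) = n.+1.
Proof. by rewrite size_polyDl size_polyXn // ltnS size_poly. Qed.

Lemma monic_of_monic n v : @monic_of n v \is monic.
Proof.
by apply/monicP; rewrite lead_coefDl ?lead_coefXn // size_polyXn ltnS size_poly.
Qed.

Definition monic_coefs n (G : {poly 'F_p}) : 'rV['F_p]_n := poly_rV (G - 'X^n).

Lemma monic_ofK n : cancel (@monic_of n) (monic_coefs n).
Proof. by move=> v; rewrite /monic_coefs /monic_of addrC addrA addNr add0r rVpolyK. Qed.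

Lemma monic_coefsK n G : G \is monic -> size G = n.+1 -> monic_of (monic_coefs n G) = G.
Proof.
move=> mG szG; rewrite /monic_of poly_rV_K ?subrKC //.
apply/leq_sizeP => j nj; rewrite coefB coefXn.
have [->|jn] := eqVneq j n; last by rewrite subr0 nth_default // szG; lia.
by move: mG => /monicP; rewrite lead_coefE szG /= => ->; rewrite subrr.
Qed.

Section Newton.
Variables (C : comNzRingType) (Phi : {poly 'F_p} -> C).
Hypothesis PhiM : {morph Phi : f g / f * g}.

(** Coefficient of the L-series attached to [Phi]. *)
Definition monic_sum n := \sum_v Phi (@monic_of n v).
(** Coefficient of the logarithmic derivative of the L-series attached to
    [Phi]. *)
Definition frob_sum n := \sum_(x <- Fq n) Phi (orbit_polyFp n x).

(** Division by [M] puts the monic multiples of [M] of degree [n] in bijection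
    with the monic polynomials of degree [n - i]. *)
Lemma sum_multiples (M : {poly 'F_p}) n i : (i <= n)%N -> M \is monic -> size M = i.+1 ->
  \sum_(v | M %| @monic_of n v) Phi (monic_of v) = Phi M * monic_sum (n - i).
Proof.
move=> lein mM szM; have M0 := monic_neq0 mM.
have szMw (w : 'rV_(n - i)) : size (M * monic_of w) = n.+1.
  by rewrite size_mul ?monic_neq0 ?monic_of_monic // size_monic_of szM; lia.
rewrite mulr_sumr (reindex_onto (fun w : 'rV_(n - i) => monic_coefs n (M * monic_of w))
   (fun v => monic_coefs (n - i) (monic_of v %/ M))) /=.
  have uK w : monic_of (monic_coefs n (M * monic_of w)) = M * @monic_of (n - i) w.
    by rewrite monic_coefsK ?monicMl ?monic_of_monic.
  apply: eq_big => w; rewrite uK; last by rewrite PhiM.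
  by rewrite mulrC mulpK // monic_ofK eqxx andbT dvdp_mull.
move=> v dv; rewrite monic_coefsK ?monic_ofK //.
- by rewrite mulrC divpK // monic_ofK.
- by have := monic_of_monic v; rewrite -{1}(divpK dv) monicMr.
- by rewrite size_divp // size_monic_of szM /= subSn.
Qed.

(** Weight every monic [G] of degree [n] by [n], written as a count of divisors
    as in [sum_orbit_dvd], and exchange the two summations. *)
Lemma newton_monic_sum n :
  n%:R * monic_sum n = \sum_(1 <= i < n.+1) frob_sum i * monic_sum (n - i).
Proof.
rewrite mulr_sumr.
under eq_bigr => v _ do
  rewrite -[n in n%:R](sum_orbit_dvd (monic_of_monic v) (size_monic_of v)) natr_sum mulr_suml.
rewrite exchange_big /= !big_nat; apply: eq_bigr => i /andP[i0 ilt].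
rewrite mulr_suml.
under eq_bigr => v _ do rewrite natr_sum mulr_suml.
rewrite exchange_big /=; apply: eq_big_seq => x xi.
rewrite -sum_multiples ?orbit_polyFp_monic ?size_orbit_polyFp // [RHS]big_mkcond.
by apply: eq_bigr => v _; case: ifP => _; rewrite ?mul1r ?mul0r.
Qed.
End Newton.
End Closure.

(** * Character sums over extensions of the prime field *)

Section Char.
Variables (p : nat) (C : numFieldType) (chi : 'F_p -> C).
Hypothesis p_pr : prime p.
Hypothesis p_gt2 : (2 < p)%N.
Hypothesis chiM : {morph chi : x y / x * y}.
Hypothesis chi1 : chi 1 = 1.
Hypothesis chi0 : chi 0 = 0.
Hypothesis chi_nontriv : exists2 u, u != 0 & chi u != 1.

Lemma chiX x n : chi (x ^+ n) = chi x ^+ n.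
Proof. by elim: n => [|n IH]; rewrite ?expr0 ?chi1 // !exprS chiM IH. Qed.

Lemma Fp_fermat (x : 'F_p) : x != 0 -> x ^+ p.-1 = 1.
Proof.
move=> x0; apply: (mulfI x0); rewrite mulr1 -exprS prednK ?prime_gt0 //.
by have := expf_card x; rewrite card_Fp.
Qed.

Lemma norm_chi x : x != 0 -> `|chi x| = 1.
Proof.
move=> x0; apply/eqP; rewrite -(@pexpr_eq1 _ _ p.-1) //; last by lia.
by rewrite -normrX -chiX Fp_fermat // chi1 normr1.
Qed.

Lemma sum_char_mul (f : 'F_p -> C) (u : 'F_p) : u != 0 -> f u != 1 ->
  {morph f : x y / x * y} -> \sum_x f x = 0.
Proof.
move=> u0 fu fM; have E : f u * (\sum_x f x) = \sum_x f x.
  rewrite mulr_sumr [RHS](reindex_inj (mulfI u0)).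
  by apply: eq_bigr => x _; rewrite fM.
move/eqP: E; rewrite -subr_eq0 -{2}[\sum_x f x]mul1r -mulrBl mulf_eq0 subr_eq0.
by rewrite (negPf fu) => /eqP.
Qed.

Lemma sum_chi : \sum_x chi x = 0.
Proof. by case: chi_nontriv => u u0 cu; apply: (sum_char_mul u0 cu chiM). Qed.

(** As [n] is prime to [p - 1], every nonzero element is an [n]-th power, so
    [x |-> chi (x ^+ n)] is again nontrivial. *)
Lemma sum_chi_coprime n : coprime n p.-1 -> \sum_x chi (x ^+ n) = 0.
Proof.
move=> con; case: chi_nontriv => u u0 cu.
have n0 : (0 < n)%N by case: n con => // /eqP; rewrite gcd0n; lia.
have [f fE] : exists f, (u ^+ f) ^+ n = u.
  case: (egcdnP p.-1 n0) => a b ab _; exists a.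
  rewrite -exprM ab (eqP con) exprD expr1 mulnC exprM Fp_fermat //.
  by rewrite expr1n mul1r.
apply: (@sum_char_mul _ (u ^+ f)); rewrite ?expf_neq0 ?fE //.
by move=> x y; rewrite exprMn chiM.
Qed.

Variables (e : 'F_p -> nat) (a0 : 'F_p).
Hypothesis e_coprime : coprime (e a0) p.-1.

(** The completely multiplicative function whose value at ['X + k] is the
    summand of the shifted character sum. *)
Definition char_eval (g : {poly 'F_p}) : C := chi (\prod_a g.[a] ^+ e a).

Lemma char_evalM : {morph char_eval : f g / f * g}.
Proof.
move=> f g; rewrite /char_eval -chiM -big_split; congr chi.
by apply: eq_bigr => a _; rewrite hornerM exprMn.
Qed.

Definition exp_support := [set a | e a != 0%N].

Lemma a0_exp_support : a0 \in exp_support.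
Proof. by rewrite inE; apply: contraTneq e_coprime => ->; rewrite /coprime gcd0n; lia. Qed.

(** Adding the multiples [c *: l] of a polynomial [l] that vanishes on the
    exponent support except at [a0] permutes the monic polynomials of degree
    [n], and moves the value at [a0] through the whole field while the values
    at the other points stay fixed; the sum over [c] vanishes by
    [sum_chi_coprime]. *)
Lemma monic_sum_eq0 n : (#|exp_support| <= n)%N -> monic_sum char_eval n = 0.
Proof.
move=> Jn; pose l := \prod_(a in exp_support :\ a0) ('X - a%:P) : {poly 'F_p}.
have szl : (size l <= n)%N.
  rewrite /l size_prod => [|a _]; last by rewrite polyXsubC_eq0.
  under eq_bigr => a _ do rewrite size_XsubC.
  rewrite sum_nat_const; have := cardsD1 a0 exp_support; rewrite a0_exp_support => E.
  by move: Jn; rewrite E add1n; move: #|_| => k; lia.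
have la0 : l.[a0] != 0.
  rewrite /l horner_prod; apply/prodf_neq0 => a; rewrite !inE => /andP[aa0 _].
  by rewrite hornerXsubC subr_eq0 eq_sym.
have la a : a != a0 -> e a != 0%N -> l.[a] = 0.
  move=> aa0 ea; rewrite /l horner_prod (bigD1 a) ?inE ?aa0 //=.
  by rewrite hornerXsubC subrr mul0r.
have pC0 : (p%:R : C) != 0 by rewrite pnatr_eq0; lia.
apply: (mulfI pC0); rewrite mulr0.
(* Averaging over [c] needs a factor [p], which is invertible in [C]. *)
transitivity (\sum_(c : 'F_p) \sum_v char_eval (@monic_of p n v + c *: l)).
  rewrite mulr_natl -[X in _ *+ X](card_Fp p_pr) -sumr_const; apply: eq_bigr => c _.
  rewrite /monic_sum (reindex_inj (addIr (poly_rV (c *: l)))); apply: eq_bigr => v _.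
  congr char_eval; rewrite /monic_of linearD /= poly_rV_K ?addrA //.
  exact: leq_trans (size_scale_leq _ _) szl.
rewrite exchange_big /= big1 // => v _.
pose K := \prod_(a | a != a0) (monic_of v).[a] ^+ e a.
transitivity (\sum_(c : 'F_p) chi K * chi (((monic_of v).[a0] + c * l.[a0]) ^+ e a0)).
  apply: eq_bigr => c _; rewrite -chiM /char_eval; congr chi.
  rewrite (bigD1 a0) //= mulrC hornerD hornerZ; congr (_ * _).
  apply: eq_bigr => a aa0; have [->|ea] := eqVneq (e a) 0%N; first by rewrite !expr0.
  by rewrite hornerD hornerZ la // mulr0 addr0.
rewrite -mulr_sumr.
suff <- : \sum_x chi (x ^+ e a0) = \sum_c chi (((monic_of v).[a0] + c * l.[a0]) ^+ e a0).
  by rewrite sum_chi_coprime ?mulr0.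
by apply: (reindex_inj (h := fun c => (monic_of v).[a0] + c * l.[a0])) => c c' /addrI /(mulIf
  la0).
Qed.

Section PowerSums.
Variables (L : closedFieldType) (phi : {rmorphism 'F_p -> L}).
Let pL : p \in [pchar L] := pchar_closure phi p_pr.

Definition root_poly : {poly L} := \prod_a ((phi a)%:P - 'X) ^+ e a.

Lemma size_root_poly : (size root_poly <= (\sum_a e a).+1)%N.
Proof.
rewrite /root_poly; apply: (big_ind2 (fun (f : {poly L}) n => size f <= n.+1)%N).
- by rewrite size_poly1.
- by move=> f n g k hf hg; apply: size_mul_le.
move=> a _; rewrite -[e a in X in (_ <= X)%N]muln1; apply: size_exp_le.
by rewrite -opprB size_polyN size_XsubC.
Qed.

Lemma root_poly_factor : exists2 f1 : {poly L},
  root_poly = ('X - (phi a0)%:P) ^+ e a0 * f1 & f1.[phi a0] != 0.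
Proof.
exists ((-1) ^+ e a0 * \prod_(a | a != a0) ((phi a)%:P - 'X) ^+ e a).
  rewrite /root_poly (bigD1 a0) //= mulrA; congr (_ * _).
  by rewrite -exprMn mulrN1 opprB.
rewrite hornerM horner_exp hornerN hornerC mulf_neq0 ?expf_neq0 ?oppr_eq0 ?oner_eq0 //.
rewrite horner_prod; apply/prodf_neq0 => a aa0.
by rewrite horner_exp hornerD hornerN hornerX hornerC expf_neq0 // subr_eq0 (inj_eq
  (fmorph_inj phi)).
Qed.

Lemma Fp_point_expn j a : phi a ^+ (p ^ j) = phi a.
Proof.
elim: j => [|j IH]; first by rewrite expn0 expr1.
rewrite expnSr exprM IH -rmorphXn; congr (phi _).
by have := expf_card a; rewrite card_Fp.
Qed.

(** The value at [a] of the characteristic polynomial of [z] is the norm of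
    [a - z]. *)
Lemma orbit_polyFp_horner n z a : (0 < n)%N -> z \in Fq p L n ->
  phi (orbit_polyFp phi n z).[a] = (phi a - z) ^+ (\sum_(j < n) p ^ j).
Proof.
move=> n0 zn; rewrite -horner_map map_orbit_polyFp // /orbit_poly horner_prod /=.
rewrite -prodrXr; apply: eq_bigr => j _.
by rewrite hornerXsubC (Xpn_subX_sub phi) // Fp_point_expn.
Qed.

Lemma char_eval_arg_norm n z : (0 < n)%N -> z \in Fq p L n ->
  phi (\prod_a (orbit_polyFp phi n z).[a] ^+ e a) = root_poly.[z] ^+ (\sum_(j < n) p ^ j).
Proof.
move=> n0 zn; rewrite rmorph_prod /root_poly horner_prod -prodrXl.
apply: eq_bigr => a _.
by rewrite rmorphXn /= orbit_polyFp_horner // horner_exp hornerD hornerC hornerN hornerX exprAC.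
Qed.

Let D := (\sum_a e a)%N.

(** The sum is [\sum_c chi c *+ cnt c], where [cnt c] counts the elements at
    which the norm of [root_poly] is [c].  For [c != 0], [stepanov] gives
    [cnt c <= B] with [B] close to [p ^ n / (p - 1)].  As the [chi c] add up
    to zero, each [cnt c] may be replaced by [cnt c - B], and the deficits
    [B - cnt c] have a small total because the [cnt c] add up to [p ^ n]. *)
Lemma frob_sum_bound m : (0 < m)%N -> (D + p.-1 * e a0 + 1 < p ^ m)%N ->
  `|frob_sum phi char_eval (3 * m)| <= (D * p * p ^ (2 * m))%:R.
Proof.
move=> m0 ltP; set n := (3 * m)%N.
have n0 : (0 < n)%N by rewrite muln_gt0.
pose d := p.-1; pose w := (\sum_(j < m) p ^ j)%N; pose v := (\sum_(j < 2 * m) p ^ j)%N.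
have geo k : (p ^ k = (d * \sum_(j < k) p ^ j).+1)%N.
  by rewrite -predn_exp prednK // expn_gt0 prime_gt0.
have PE : (p ^ m = (d * w).+1)%N by apply: geo.
have QE : (p ^ (2 * m) = (d * v).+1)%N by apply: geo.
have QP : (p ^ (2 * m) = p ^ m * p ^ m)%N by rewrite mul2n -addnn expnD.
have nE : (p ^ n = p ^ m * p ^ (2 * m))%N by rewrite -expnD /n; congr (_ ^ _)%N; lia.
have d1 : (1 < d)%N by rewrite /d; lia.
have NE : (\sum_(j < n) p ^ j = v * (d * w).+1 + w)%N.
  apply/eqP; rewrite -(eqn_pmul2l (ltnW d1)) -eqSS -geo nE PE QE; apply/eqP; clear; nia.
pose s z := \prod_a (orbit_polyFp phi n z).[a] ^+ e a.
have phis z : z \in Fq p L n -> phi (s z) = root_poly.[z] ^+ (v * (d * w).+1 + w).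
  by move=> zn; rewrite /s char_eval_arg_norm // NE.
pose cnt c := count (fun z => s z == c) (Fq p L n).
pose B := (w * (d * v).+1 + w * D + d * v * D)%N.
have [f1 f1E f1n0] := root_poly_factor.
(* [Q = P ^ 2] exceeds any fixed multiple of [P] once [P] is large. *)
have ltv : (d * (w * D) + d * e a0 < d * v)%N.
  move: ltP QP; rewrite -/d QE PE; clear; nia.
have cntB c : c != 0 -> (cnt c <= B)%N.
  move=> c0; rewrite /cnt -size_filter.
  apply: (stepanov pL PE d1 e_coprime f1E f1n0 size_root_poly ltv (c := phi c)).
  - by rewrite fmorph_eq0.
  - by rewrite filter_uniq // (uniq_Fq phi).
  - move=> z; rewrite mem_filter => /andP[_]; rewrite mem_Fq // nE PE QE => /eqP zq.
    by rewrite -{1}PE -{1}QE -nE (Xpn_subX_sub phi) // Fp_point_expn nE PE QE zq.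
  - by move=> z; rewrite mem_filter => /andP[/eqP <- zF]; rewrite -phis.
have cnt0 : (cnt 0%R <= D)%N.
  have r0 : root_poly != 0.
    by apply: contraNneq f1n0 => r0; move/eqP: f1E; rewrite r0 eq_sym mulf_eq0 expf_eq0
      polyXsubC_eq0 andbF => /eqP ->; rewrite horner0.
  rewrite -ltnS /cnt -size_filter; apply: leq_trans size_root_poly.
  apply: max_poly_roots => //; last by rewrite filter_uniq // (uniq_Fq phi).
  apply/allP => z; rewrite mem_filter => /andP[/eqP sz zF].
  by move: (phis z zF); rewrite sz rmorph0 => /esym/eqP; rewrite expf_eq0 => /andP[].
have SE : frob_sum phi char_eval n = \sum_c chi c *+ cnt c.
  rewrite /frob_sum (partition_big s xpredT) //=; apply: eq_bigr => c _.
  rewrite (eq_bigr (fun=> chi c)) => [|z /eqP <-//].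
  by rewrite big_const_seq iter_addr addr0.
have sumcnt : (\sum_c cnt c = p ^ n)%N.
  rewrite -(@size_Fq p L p_pr n n0) -sum1_size (partition_big s xpredT) //=.
  by apply: eq_bigr => c _; rewrite sum1_count.
have nat_le : (\sum_(c | c != 0%R) (B - cnt c) <= D * p * p ^ (2 * m))%N.
  have E : (\sum_(c | c != 0%R) (B - cnt c) + \sum_(c | c != 0%R) cnt c = d * B)%N.
    rewrite -big_split /= (eq_bigr (fun=> B)) => [|c c0]; last by rewrite subnK ?cntB.
    rewrite sum_nat_const; congr (_ * _)%N.
    by rewrite -[d]/(p.-1) -[in RHS](card_Fp p_pr) -(cardC1 (0 : 'F_p)).
  move: sumcnt; rewrite (bigD1 (0 : 'F_p)) //= => sumcnt.
  move: E cnt0 sumcnt; set X := (\sum_(c | _) (B - _))%N; set Y := (\sum_(c | _) _)%N.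
  move: QP; rewrite nE QE PE /B; clearbody X Y; move: (cnt 0%R) => k.
  have pE : p = d.+1 by rewrite /d; lia.
  rewrite [in (_ * p)%N]pE; clear; nia.
apply: (@le_trans _ _ (\sum_(c | c != 0%R) (B - cnt c))%N%:R); last by rewrite ler_nat.
have -> : frob_sum phi char_eval n = - \sum_(c | c != 0) chi c *+ (B - cnt c).
  apply/eqP; rewrite -addr_eq0 SE (bigD1 0) //= chi0 mul0rn add0r -big_split /=.
  rewrite (eq_bigr (fun c => chi c *+ B)) => [|c c0]; last by rewrite -mulrnDr subnKC ?cntB.
  by rewrite sumrMnl; have := sum_chi; rewrite (bigD1 0) //= chi0 add0r => ->; rewrite mul0rn.
rewrite normrN natr_sum; apply: le_trans (ler_norm_sum _ _ _) _; apply: ler_sum => c c0.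
by rewrite normrMn norm_chi.
Qed.
End PowerSums.
End Char.

(** * From power sums to roots: a weak Weil bound *)

(** The roots of this polynomial are the inverses of the nonzero entries of [ws]. *)
Definition rev_prod (C : comNzRingType) (ws : seq C) : {poly C} := \prod_(w <- ws) (1 - w *: 'X).

Lemma coef_rev_prod_cons (C : comNzRingType) (w : C) ws k :
  (rev_prod (w :: ws))`_k.+1 = (rev_prod ws)`_k.+1 - w * (rev_prod ws)`_k.
Proof. by rewrite /rev_prod big_cons mulrBl mul1r -scalerAl coefB coefZ coefXM. Qed.

Lemma coef0_rev_prod (C : comNzRingType) (ws : seq C) : (rev_prod ws)`_0 = 1.
Proof.
rewrite -horner_coef0 /rev_prod horner_prod big1 // => w _.
by rewrite !hornerE ?mulr0 subr0.
Qed.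

(** Newton's identities.  When a root [w] is added, the new power sum
    [w ^ i] contributes a telescoping sum. *)
Lemma newton_rev_prod (C : comNzRingType) (ws : seq C) k :
  k%:R * (rev_prod ws)`_k =
  - \sum_(1 <= i < k.+1) (\sum_(w <- ws) w ^+ i) * (rev_prod ws)`_(k - i).
Proof.
elim: ws k => [|w ws IH] k.
  rewrite /rev_prod big_nil coef1 big1 ?oppr0; last by move=> i _; rewrite big_nil mul0r.
  by case: k => [|k]; rewrite ?mul0r ?mulr0.
case: k => [|k]; first by rewrite mul0r big_geq // oppr0.
have tel : \sum_(1 <= i < k.+2) w ^+ i * (rev_prod (w :: ws))`_(k.+1 - i) = w * (rev_prod ws)`_k.
  have telk j : (j <= k)%N -> \sum_(k.+1 - j <= i < k.+2) w ^+ i * (rev_prod (w ::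
    ws))`_(k.+1 - i) =
      w ^+ (k.+1 - j) * (rev_prod ws)`_j.
    elim: j => [|j IHj] jk.
      by rewrite subn0 big_nat1 subnn !coef0_rev_prod.
    rewrite big_ltn ?subSS; last by lia.
    have -> : (k - j).+1 = (k.+1 - j)%N by lia.
    rewrite IHj; last by lia.
    have -> : (k.+1 - (k - j))%N = j.+1 by lia.
    rewrite coef_rev_prod_cons.
    have -> : (k.+1 - j)%N = (k - j).+1 by lia.
    by rewrite exprS; ring.
  by have := telk k (leqnn k); rewrite subSn // subnn expr1.
rewrite (eq_bigr (fun i => (\sum_(w <- ws) w ^+ i) * (rev_prod (w :: ws))`_(k.+1 - i) +
     w ^+ i * (rev_prod (w :: ws))`_(k.+1 - i))); last first.
  by move=> i _; rewrite big_cons mulrDl addrC.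
rewrite big_split /= tel.
have -> : \sum_(1 <= i < k.+2) (\sum_(w <- ws) w ^+ i) * (rev_prod (w :: ws))`_(k.+1 - i) =
   \sum_(1 <= i < k.+2) (\sum_(w <- ws) w ^+ i) * (rev_prod ws)`_(k.+1 - i) -
   w * \sum_(1 <= i < k.+1) (\sum_(w <- ws) w ^+ i) * (rev_prod ws)`_(k - i).
  rewrite !(@big_nat_recr _ _ _ k.+1 1) //= subnn !coef0_rev_prod mulr_sumr addrAC -sumrB.
  congr (_ + _); apply: eq_big_nat => i /andP[_ ik].
  by rewrite subSn // coef_rev_prod_cons; ring.
have /esym/eqP := IH k; have /esym/eqP := IH k.+1.
rewrite !eqr_oppLR => /eqP -> /eqP ->; rewrite coef_rev_prod_cons -[k.+1%:R]natr1.
by ring.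
Qed.

Lemma rev_prod_exists (C : closedFieldType) (H : {poly C}) : H`_0 = 1 ->
  exists2 ws, H = rev_prod ws & (size ws <= (size H).-1)%N.
Proof.
move=> H0; have [rs HE] := closed_field_poly_normal H.
have Hn0 : H != 0 by apply: contra_eq_neq H0 => ->; rewrite coef0 eq_sym oner_eq0.
have l0 : lead_coef H != 0 by rewrite lead_coef_eq0.
have rs0 z : z \in rs -> z != 0.
  move=> zr; apply: contra_eq_neq H0 => z0; rewrite -horner_coef0 HE hornerZ horner_prod.
  rewrite (big_rem z) //= hornerXsubC z0 subr0 mul0r mulr0 eq_sym; exact: oner_neq0.
have szH : (size rs = (size H).-1)%N.
  by rewrite HE size_scale // size_prod_XsubC.
exists [seq z^-1 | z <- rs]; last by rewrite size_map szH.
have E : H = (lead_coef H * \prod_(z <- rs) (- z)) *: rev_prod [seq z^-1 | z <- rs].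
  rewrite {1}HE -scalerA; congr (_ *: _); rewrite /rev_prod big_map -scaler_prod.
  apply: eq_big_seq => z zr; rewrite scalerBr scalerA mulNr mulfV ?rs0 //.
  by rewrite scaleN1r opprK addrC -mul_polyC mulr1 polyCN.
have := congr1 (fun q : {poly C} => q`_0) E; rewrite /= coefZ coef0_rev_prod mulr1 H0 => c1.
by rewrite {1}E -c1 scale1r.
Qed.

(** Newton's identities determine the power sums from the coefficients. *)
Lemma newton_unique (C : comNzRingType) (h S : nat -> C) (ws : seq C) :
  (forall n, n%:R * h n = \sum_(1 <= i < n.+1) S i * h (n - i)%N) ->
  (forall n, h n = (rev_prod ws)`_n) ->
  forall n, (0 < n)%N -> S n = - \sum_(w <- ws) w ^+ n.
Proof.
move=> newt hE; elim/ltn_ind => n IH n0.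
have := newt n; have := newton_rev_prod ws n; rewrite -hE => ->.
rewrite !(@big_nat_recr _ _ _ n 1) //= subnn -hE !hE coef0_rev_prod !mulr1 opprD -sumrN.
rewrite (eq_big_nat _ _ (F2 := fun i => S i * h (n - i)%N)).
  by move/addrI => <-.
by move=> i /andP[i0 lti]; rewrite IH // hE mulNr.
Qed.

Section Growth.
Variable R : realType.
Local Notation C := (R[i]).
Local Notation nm := (@ComplexField.Normc.normc R).

(** The norm of [R[i]] is complex valued; [nm] is its real counterpart, for
    which the arithmetic of ordered fields applies. *)
Lemma nmE (z : C) : `|z| = real_complex R (nm z).
Proof. by case: z. Qed.

Lemma nm_le (z : C) (x : R) : (`|z| <= real_complex R x) = (nm z <= x).
Proof. by rewrite nmE lecR. Qed.

Lemma nm_ge0 (z : C) : 0 <= nm z.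
Proof. by case: z => a b; apply: sqrtr_ge0. Qed.

Lemma nm0 : nm 0 = 0. Proof. exact: ComplexField.Normc.normc0. Qed.
Lemma nm1 : nm 1 = 1. Proof. exact: ComplexField.Normc.normc1. Qed.
Lemma nmM (x y : C) : nm (x * y) = nm x * nm y.
Proof. exact: ComplexField.Normc.normcM. Qed.
Lemma nmN (x : C) : nm (- x) = nm x.
Proof. by apply: complexI; rewrite -!nmE normrN. Qed.
Lemma nmX (x : C) n : nm (x ^+ n) = nm x ^+ n.
Proof. by apply: complexI; rewrite rmorphXn /= -!nmE normrX. Qed.
Lemma nm_nat n : nm n%:R = n%:R.
Proof. by apply: complexI; rewrite -nmE rmorph_nat normr_nat. Qed.
Lemma nmD (x y : C) : nm (x + y) <= nm x + nm y.
Proof. by rewrite -nm_le rmorphD /= -!nmE ler_normD. Qed.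
Lemma nm_eq0 (x : C) : (nm x == 0) = (x == 0).
Proof. by rewrite -(normr_eq0 x) nmE -(rmorph0 (real_complex R)) (inj_eq (@complexI R)). Qed.
Lemma nm_sum I (r : seq I) (P : pred I) (F : I -> C) :
  nm (\sum_(i <- r | P i) F i) <= \sum_(i <- r | P i) nm (F i).
Proof.
rewrite -nm_le rmorph_sum /=; apply: le_trans (ler_norm_sum _ _ _) _.
by apply: ler_sum => i _; rewrite nmE.
Qed.

Lemma geo_le (A : R) k : 0 <= A -> \sum_(1 <= i < k.+1) A * (1 + A) ^+ (k - i) <= (1 + A) ^+ k.
Proof.
move=> A0; suff -> : \sum_(1 <= i < k.+1) A * (1 + A) ^+ (k - i) = (1 + A) ^+ k - 1 by lra.
elim: k => [|k IH]; first by rewrite big_geq // expr0 subrr.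
rewrite big_ltn // subSS subn0 big_add1 /=.
rewrite (eq_big_nat _ _ (F2 := fun i => A * (1 + A) ^+ (k - i))); last by [].
by rewrite IH exprS; ring.
Qed.

(** Induction along Newton's identities; the factor [(1 + K) ^+ k] absorbs the
    convolution by [geo_le]. *)
Lemma coef_growth (ws : seq C) (K y : R) : 0 <= K -> 0 <= y ->
  (forall i, (0 < i)%N -> nm (\sum_(w <- ws) w ^+ i) <= K * y ^+ i) ->
  forall k, nm (rev_prod ws)`_k <= (1 + K) ^+ k * y ^+ k.
Proof.
move=> K0 y0 hp; elim/ltn_ind => k IH.
case: k IH => [|k] IH; first by rewrite coef0_rev_prod nm1 !expr0 mul1r.
have := congr1 nm (newton_rev_prod ws k.+1); rewrite nmM nmN nm_nat => E.
apply: (@le_trans _ _ (k.+1%:R * nm (rev_prod ws)`_k.+1)).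
  by rewrite ler_peMl ?nm_ge0 // ler1n.
rewrite {}E; apply: le_trans (nm_sum _ _ _) _.
apply: (@le_trans _ _ (\sum_(1 <= i < k.+2) K * (1 + K) ^+ (k.+1 - i) * y ^+ k.+1)).
  rewrite !big_nat; apply: ler_sum => i /andP[i0 ik]; rewrite nmM.
  have -> : y ^+ k.+1 = y ^+ i * y ^+ (k.+1 - i) by rewrite -exprD; congr (_ ^+ _); lia.
  have -> : K * (1 + K) ^+ (k.+1 - i) * (y ^+ i * y ^+ (k.+1 - i)) =
    K * y ^+ i * ((1 + K) ^+ (k.+1 - i) * y ^+ (k.+1 - i)) by ring.
  by apply: ler_pM; rewrite ?nm_ge0 ?hp ?IH //; lia.
by rewrite -mulr_suml ler_wpM2r ?exprn_ge0 ?geo_le.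
Qed.

(** If [nm w] exceeded [2 * A], the terms of positive degree at [w^-1] would add
    up to less than [1] and could not cancel the constant term [1]. *)
Lemma root_growth (ws : seq C) (A : R) : 0 < A ->
  (forall k, nm (rev_prod ws)`_k <= A ^+ k) -> {in ws, forall w, nm w <= 2 * A}.
Proof.
move=> A0 hA w wws; rewrite leNgt; apply/negP => lt.
have w0 : w != 0 by rewrite -nm_eq0; apply: lt0r_neq0; apply: lt_trans lt; rewrite mulr_gt0.
have : (rev_prod ws).[w^-1] = 0.
  rewrite /rev_prod horner_prod (big_rem w) //= hornerD hornerN hornerZ hornerX hornerC.
  by rewrite mulfV // subrr mul0r.
rewrite horner_coef.
case sz : (size (rev_prod ws)) => [|n].
  have : (rev_prod ws)`_0 = 0 by rewrite nth_default // sz.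
  by rewrite coef0_rev_prod => /eqP; rewrite oner_eq0.
rewrite big_ord_recl /= expr0 mulr1 coef0_rev_prod => /eqP; rewrite addr_eq0 => /eqP E.
have := nm1; rewrite E nmN => E1.
suff : \sum_(i < n) nm ((rev_prod ws)`_(bump 0 i) * w^-1 ^+ bump 0 i) < 1.
  by rewrite ltNge -{1}E1 nm_sum.
apply: (@le_lt_trans _ _ (\sum_(i < n) (2^-1 : R) ^+ i.+1)).
  apply: ler_sum => i _; rewrite /bump add1n nmM nmX ComplexField.Normc.normcV.
  have wp : 0 < nm w by apply: lt_trans lt; rewrite mulr_gt0.
  apply: (@le_trans _ _ (A ^+ i.+1 * (nm w)^-1 ^+ i.+1)).
    by rewrite ler_wpM2r ?hA // exprn_ge0 // invr_ge0 ltW.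
  have h0 : 0 <= A * (nm w)^-1 by rewrite divr_ge0 ?ltW.
  have h1 : A * (nm w)^-1 <= 2^-1 by rewrite ler_pdivrMr //; lra.
  by rewrite -exprMn; apply: lerXn2r; rewrite ?nnegrE ?invr_ge0.
have -> : \sum_(i < n) (2^-1 : R) ^+ i.+1 = 1 - 2^-1 ^+ n.
  elim: n {sz E E1} => [|n IH]; first by rewrite big_ord0 expr0 subrr.
  by rewrite big_ord_recr /= IH exprS; lra.
by rewrite ltrBlDr ltrDl exprn_gt0 // invr_gt0.
Qed.

(** Bernoulli's inequality and the archimedean property. *)
Lemma bounded_ratio (z y A : R) : 0 < y ->
  (exists m0 : nat, forall m, (m0 <= m)%N -> z ^+ m <= A * y ^+ m) ->
  z <= y.
Proof.
move=> y0 [m0 hm]; rewrite leNgt; apply/negP => lt.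
pose t := z / y - 1.
have t0 : 0 < t by rewrite subr_gt0 ltr_pdivlMr // mul1r.
have bern m : 1 + m%:R * t <= (z / y) ^+ m.
  elim: m => [|m IH]; first by rewrite mul0r addr0 expr0.
  have zy : z / y = 1 + t by rewrite /t addrC subrK.
  rewrite exprS; apply: (@le_trans _ _ ((z / y) * (1 + m%:R * t))); last first.
    by rewrite ler_pM2l // divr_gt0 // (lt_trans y0).
  rewrite zy -natr1; have : 0 <= (m%:R : R) by apply: ler0n.
  by nra.
have [m mA] : exists m : nat, `|A| / t < m%:R.
  by exists (Num.trunc (`|A| / t)).+1; apply: truncnS_gt.
have mmA : `|A| / t < (m0 + m)%:R.
  by apply: lt_le_trans mA _; rewrite ler_nat leq_addl.
have := hm (m0 + m)%N (leq_addr _ _); rewrite -ler_pdivrMr ?exprn_gt0 // -expr_div_n.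
move/(le_trans (bern _)); have := ler_norm A; move: mmA; rewrite ltr_pdivrMr //; lra.
Qed.

(** The constant [K] is removed by a tensor power argument: the bound is applied
    to the powers [w ^ (3 m)] for all large [m], and a fixed factor does not
    affect the limit of [m]-th roots. *)
Lemma power_sum_growth (ws : seq C) (K y : R) (m0 : nat) : 0 <= K -> 0 < y ->
  (forall m, (m0 <= m)%N -> nm (\sum_(w <- ws) w ^+ (3 * m)) <= K * y ^+ m) ->
  {in ws, forall w, nm w ^+ 3 <= y}.
Proof.
move=> K0 y0 hp w wws; apply: (@bounded_ratio _ _ (2 * (1 + K))) => //.
exists m0.+1 => m m0m; pose ws' := [seq w ^+ (3 * m) | w <- ws].
rewrite -exprM -nmX -mulrA; apply: (@root_growth ws'); last by apply/mapP; exists w.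
  by rewrite mulr_gt0 ?exprn_gt0 //; lra.
move=> k; rewrite exprMn; apply: coef_growth => //; first by rewrite exprn_ge0 // ltW.
move=> i i0; rewrite big_map -exprM.
under eq_bigr => u _ do rewrite -exprM -mulnA.
by apply: hp; nia.
Qed.
End Growth.

Section Weil.
Variables (R : realType) (p : nat) (chi : 'F_p -> R[i]).
Local Notation nm := (@ComplexField.Normc.normc R).
Hypothesis p_pr : prime p.
Hypothesis p_gt2 : (2 < p)%N.
Hypothesis chiM : {morph chi : x y / x * y}.
Hypothesis chi1 : chi 1 = 1.
Hypothesis chi0 : chi 0 = 0.
Hypothesis chi_nontriv : exists2 u, u != 0 & chi u != 1.

Lemma monic_sum0 (C : comNzRingType) (f : {poly 'F_p} -> C) : monic_sum f 0 = f 1.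
Proof.
rewrite /monic_sum (big_pred1 0) => [|v]; last by rewrite /= [v]thinmx0 eqxx.
by rewrite /monic_of expr0 raddf0 addr0.
Qed.

Lemma monic_sum1 (e : 'F_p -> nat) :
  monic_sum (char_eval chi e) 1 = \sum_k chi (\prod_a (k + a) ^+ e a).
Proof.
rewrite /monic_sum (reindex_onto (fun k : 'F_p => const_mx k : 'rV_1) (fun v => v 0 0)) /=.
  apply: eq_big => k; first by rewrite mxE eqxx.
  move=> _; congr chi; apply: eq_bigr => a _; congr (_ ^+ _).
  rewrite /monic_of expr1 hornerD hornerX addrC; congr (_ + _).
  rewrite (_ : rVpoly _ = k%:P) ?hornerC //; apply/polyP => i.
  rewrite coef_rVpoly coefC; case: insubP => [j lti ij|]; last by case: i.
  by rewrite mxE; case: i lti {ij} => [|i].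
by move=> v _; apply/rowP => i; rewrite mxE ord1.
Qed.

(** [monic_sum] of degree one is the sum to be bounded, and it is minus the sum
    of the inverse roots of the L-polynomial, of which there are fewer than
    the size of the exponent support. *)
Theorem weil_bound (e : 'F_p -> nat) (a0 : 'F_p) (y : R) :
  coprime (e a0) p.-1 -> 0 <= y -> y ^+ 3 = p%:R ^+ 2 ->
  nm (\sum_k chi (\prod_a (k + a) ^+ e a)) <= #|[set a | e a != 0%N]|%:R * y.
Proof.
move=> co y0 y3; rewrite -monic_sum1 -/(exp_support e); set J := #|exp_support e|.
have [L [phi _]] := countable_algebraic_closure 'F_p.
have J0 : (0 < J)%N by apply/card_gt0P; exists a0; apply: a0_exp_support.
pose h := monic_sum (char_eval chi e); pose H := \poly_(k < J) h k.
have hE n : h n = H`_n.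
  by rewrite coef_poly; case: ltnP => // /(monic_sum_eq0 p_pr p_gt2 chiM chi_nontriv co).
have H0 : H`_0 = 1.
  rewrite -hE /h monic_sum0 /char_eval big1 ?chi1 // => a _.
  by rewrite hornerC expr1n.
have [ws HE szws] := rev_prod_exists H0.
have szJ : (size ws <= J)%N.
  by apply: leq_trans szws _; apply: leq_trans (leq_pred _) (size_poly _ _).
have newt := newton_unique (newton_monic_sum phi p_pr (char_evalM chiM e)) (fun n => etrans
  (hE n) (congr1 (fun q : {poly _} => q`_n) HE)).
have h1E : h 1%N = - \sum_(w <- ws) w.
  have := newton_monic_sum phi p_pr (char_evalM chiM e) 1; rewrite mul1r big_nat1 subnn -/(h
    0%N) hE H0 mulr1 -/(h 1%N) => ->.
  by rewrite newt.
have wsy : {in ws, forall w, nm w <= y}.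
  pose D := (\sum_a e a)%N.
  (* The threshold on [m] ensures the size condition of [frob_sum_bound] through
     [m < p ^ m]. *)
  have key := @power_sum_growth R ws ((D * p)%:R) (p%:R ^+ 2) (D + p.-1 * e a0 + 1).+1 (ler0n
    _ _).
  have := key _ _; rewrite exprn_gt0 ?ltr0n ?prime_gt0 // => /(_ isT) {}key w /key wy.
  rewrite -(@ler_pXn2r _ 3) ?nnegrE ?nm_ge0 // y3; apply: wy => m mD.
  have m0 : (0 < m)%N by apply: leq_trans mD.
  have := newt (3 * m)%N; rewrite muln_gt0 m0 => /(_ isT) /esym /eqP; rewrite eqr_oppLR =>
    /eqP ->.
  rewrite nmN -exprM -natrX -natrM -nm_le rmorph_nat.
  apply: (frob_sum_bound p_pr p_gt2 chiM chi1 chi0 chi_nontriv co) => //.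
  apply: leq_trans mD _; apply: ltnW; apply: ltn_expl; exact: prime_gt1.
rewrite -/(h 1%N) h1E nmN; apply: le_trans (nm_sum _ _ _) _.
apply: (@le_trans _ _ (\sum_(w <- ws) y)).
  by rewrite big_seq [leRHS]big_seq; apply: ler_sum.
rewrite big_const_seq count_predT iter_addr addr0 -[y *+ _]mulr_natl ler_wpM2r //.
by rewrite ler_nat.
Qed.
End Weil.

Local Open Scope complex_scope.

(** * The Dirichlet kernel *)

Section Trig.
Variable R : realType.
Implicit Types x y : R.
Local Notation nm := (@ComplexField.Normc.normc R).

Lemma sin_mvt x : 0 <= x -> exists2 c, 0 <= c <= x & sin x = cos c * x.
Proof.
move=> x0; have [] := @MVT_segment R sin cos 0 x x0.
  by apply: continuous_subspaceT => y; apply: continuous_sin.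
by move=> c; rewrite in_itv /= => cx; rewrite sin0 !subr0 => ->; exists c.
Qed.

Lemma norm_sin_le x : 0 <= x -> `|sin x| <= x.
Proof.
move=> x0; have [c _ ->] := sin_mvt x0.
by rewrite normrM (ger0_norm x0) ler_piMl // cos_max.
Qed.

(** The mean value theorem at [x / 2] gives [sin (x / 2) >= x / 2 * cos (x / 2)],
    and [2 * cos (x / 2) ^+ 2 = 1 + cos x >= 1]. *)
Lemma sin_ge_half x : 0 <= x <= pi / 2 -> x / 2 <= sin x.
Proof.
move=> /andP[x0 xpi]; have pi0 := pi_gt0 R.
have h0 : 0 <= x / 2 by lra.
have [c /andP[c0 cx] E] := sin_mvt h0.
have cc : cos (x / 2) <= cos c.
  rewrite leNgt ltr_cos ?in_itv /=; first by rewrite -leNgt.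
  - by apply/andP; split; lra.
  - by apply/andP; split; lra.
have cp : 0 <= cos (x / 2) by apply: cos_ge0_pihalf; apply/andP; split; lra.
have cx0 : 0 <= cos x by apply: cos_ge0_pihalf; apply/andP; split; lra.
set z := x / 2 in h0 cx E cc cp *.
have xz : x = z *+ 2 by rewrite -mulr_natr /z; field.
clearbody z.
have sx : sin x = 2 * (cos z * (cos c * z)) by rewrite xz sin_mulr2n E [RHS]mulr_natl.
have cz : 2 * cos z ^+ 2 = cos x + 1 by rewrite xz cos_mulr2n subrK [LHS]mulr_natl.
have h1 : 1 <= 2 * (cos z * cos c) by nra.
by rewrite sx; nra.
Qed.

(** By symmetry about [1 / 2] it suffices that [sin (pi * y) >= y] on
    [0 < y <= 1 / 2], which is [sin_ge_half] together with [pi >= 2]. *)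
Lemma sin_pi_ge y : 0 < y < 1 -> 1 <= sin (pi * y) * (y^-1 + (1 - y)^-1).
Proof.
move=> /andP[y0 y1]; have pi2 := pi_ge2 R.
have iy : 0 < y^-1 by rewrite invr_gt0.
have i1y : 0 < (1 - y)^-1 by rewrite invr_gt0 subr_gt0.
have [le|gt] := leP y (1 / 2).
  have s : y <= sin (pi * y).
    apply: le_trans (_ : pi * y / 2 <= _); first by nra.
    by apply: sin_ge_half; nra.
  have : 1 <= sin (pi * y) * y^-1 by rewrite ler_pdivlMr // mul1r.
  nra.
have s : 1 - y <= sin (pi * y).
  have -> : sin (pi * y) = sin (pi * (1 - y)).
    have -> : pi * (1 - y) = - (pi * y) + pi by ring.
    by rewrite sinDpi sinN opprK.
  apply: le_trans (_ : pi * (1 - y) / 2 <= _); first by nra.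
  by apply: sin_ge_half; nra.
have : 1 <= sin (pi * y) * (1 - y)^-1 by rewrite ler_pdivlMr ?subr_gt0 // mul1r.
nra.
Qed.

Lemma eD x y : e (x + y) = e x * e y.
Proof.
rewrite /e mulrDr cosD sinD; apply/eqP; rewrite eq_complex /= eqxx /=.
by rewrite addrC.
Qed.

Lemma e0 : e (0 : R) = 1.
Proof. by rewrite /e mulr0 cos0 sin0. Qed.

Lemma nm_e x : nm (e x) = 1.
Proof. by rewrite /e /= cos2Dsin2 sqrtr1. Qed.

Lemma e1 : e (1 : R) = 1.
Proof.
by rewrite /e mulr1 mulrC mulr_natr cos2pi sin2pi.
Qed.

Lemma e_muln x n : e (n%:R * x) = e x ^+ n.
Proof.
elim: n => [|n IH]; first by rewrite mul0r e0 expr0.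
by rewrite -natr1 mulrDl mul1r eD IH exprSr.
Qed.

Lemma e_nat n : e (n%:R : R) = 1.
Proof. by rewrite -[n%:R]mulr1 e_muln e1 expr1n. Qed.

Lemma eN x : e (- x) = (e x)^-1.
Proof.
have E : e (- x) * e x = 1 by rewrite -eD addNr e0.
have ex0 : e x != 0 by apply: contraTneq (oner_neq0 R) => ex0; rewrite -(nm_e x) ex0 nm0 eqxx.
by rewrite -[LHS]mulr1 -(mulfV ex0) mulrA E mul1r.
Qed.

Lemma e_int (k : int) : e (k%:~R : R) = 1.
Proof. by case: k => n; rewrite ?e_nat // NegzE mulrNz eN e_nat invr1. Qed.

Lemma nm_e_sub1 y : nm (e y - 1) = 2 * `|sin (pi * y)|.
Proof.
have -> : e y - 1 = (cos (2 * pi * y) - 1) +i* sin (2 * pi * y).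
  by apply/eqP; rewrite eq_complex /= subr0 !eqxx.
rewrite /= ; have -> : 2 * pi * y = (pi * y) *+ 2 by rewrite -mulr_natr; ring.
rewrite cos_mulr2n sin_mulr2n; set c := cos _; set s := sin _.
have cs : c ^+ 2 = 1 - s ^+ 2 by apply: cos2sin2.
have -> : (c ^+ 2 *+ 2 - 1 - 1) ^+ 2 + ((c * s) *+ 2) ^+ 2 = (2 * s) ^+ 2.
  rewrite -[_ *+ 2]mulr_natr -[(c * s) *+ 2]mulr_natr !exprMn !cs; ring.
by rewrite sqrtr_sqr normrM ger0_norm.
Qed.
End Trig.

Section Harmonic.
Variable R : realType.
Implicit Types x y : R.

Lemma harmonic_le n : (0 < n)%N -> \sum_(1 <= i < n.+1) (i%:R : R)^-1 <= 1 + ln n%:R.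
Proof.
elim: n => // -[|n] IH _; first by rewrite big_nat1 invr1 ln1 addr0.
rewrite big_nat_recr //=; have {}IH := IH isT.
apply: le_trans (lerD IH (lexx _)) _; rewrite -addrA lerD2l -lerBrDl.
rewrite -ln_div ?posrE ?ltr0n // -lerN2.
have -> : - ln (n.+2%:R / n.+1%:R) = ln (1 + - (n.+2%:R : R)^-1).
  rewrite -lnV ?posrE ?divr_gt0 ?ltr0n //; congr ln.
  have E : (n.+1%:R : R) = n.+2%:R - 1 by rewrite -[n.+2%:R]natr1 addrK.
  by rewrite invf_div E mulrBl mulfV ?pnatr_eq0 // mul1r.
apply: le_ln1Dx; rewrite ltrN2 invf_lt1 ?ltr1n // ltr0n.
Qed.

Lemma harmonic_ge n : ln n.+1%:R <= \sum_(1 <= i < n.+1) (i%:R : R)^-1.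
Proof.
elim: n => [|n IH]; first by rewrite big_geq // ln1.
rewrite big_nat_recr //=; apply: le_trans (lerD IH (lexx _)).
rewrite -lerBlDl -ln_div ?posrE ?ltr0n //.
have -> : n.+2%:R / n.+1%:R = 1 + (n.+1%:R : R)^-1.
  by rewrite -[n.+2%:R]natr1 mulrDl mulfV ?pnatr_eq0 // mul1r.
by apply: le_ln1Dx; apply: lt_trans (_ : 0 < _); rewrite ?invr_gt0 ?ltr0n // ltrN10.
Qed.
End Harmonic.

Lemma Fp_intP (p : nat) (n : int) : prime p ->
  exists k : int, n = ((n%:~R : 'F_p) : nat)%:Z + k * p%:Z.
Proof.
move=> p_pr; have p0 := prime_gt0 p_pr.
have pn0 : (p%:Z != 0) by rewrite eqz_nat -lt0n.
exists (n %/ p%:Z)%Z; rewrite {1}(divz_eq n p%:Z) addrC; congr (_ + _).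
have r0 := modz_ge0 n pn0; have rp : (n %% p%:Z < p%:Z)%Z by apply: ltz_pmod.
have -> : n%:~R = (n %% p%:Z)%Z%:~R :> 'F_p.
  rewrite {1}(divz_eq n p%:Z) rmorphD rmorphM /= [X in _ * X + _](_ : _ = 0) ?mulr0 ?add0r //.
  exact: pchar_Fp_0.
case: (n %% p%:Z)%Z r0 rp => // r _ rp.
by rewrite -pmulrn val_Fp_nat // modn_small.
Qed.

(** Addition in ['F_p] agrees with integer addition up to a multiple of [p]; this
    transfers functions of period one between residues and reals. *)
Lemma Fp_shiftP (p : nat) (s : int) (a : 'F_p) : prime p ->
  exists k : int, s + (a : nat)%:Z = (((s%:~R + a)%R : 'F_p) : nat)%:Z + k * p%:Z.
Proof.
move=> p_pr; have E : (s + (a : nat)%:Z)%:~R = s%:~R + a :> 'F_p.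
  by rewrite intrD -pmulrn natr_Zp.
by have [k hk] := Fp_intP (s + (a : nat)%:Z) p_pr; exists k; rewrite -E.
Qed.

Lemma sum_Fp (V : nmodType) (p : nat) (f : nat -> V) : prime p ->
  \sum_(b : 'F_p) f b = \sum_(0 <= i < p) f i.
Proof. by move=> p_pr; rewrite -(big_mkord xpredT f) Fp_cast. Qed.

Section Kernel.
Variables (R : realType) (A0 L : nat).
Implicit Types x y : R.
Local Notation nm := (@ComplexField.Normc.normc R).

Definition dkernel y : R[i] := \sum_(j < L) e ((A0 + j)%:R * y).

Lemma dkernel_period y (k : int) : dkernel (y + k%:~R) = dkernel y.
Proof.
apply: eq_bigr => j _; rewrite mulrDr eD.
by rewrite -[(A0 + j)%:R * k%:~R](intrM _ (A0 + j)%N k) e_int mulr1.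
Qed.

Lemma nm_dkernel_le y : nm (dkernel y) <= L%:R.
Proof.
apply: le_trans (nm_sum _ _ _) _; under eq_bigr do rewrite nm_e.
by rewrite sumr_const card_ord.
Qed.

Lemma dkernel_sin y : `|sin (pi * y)| * nm (dkernel y) = `|sin (pi * (L%:R * y))|.
Proof.
have geo : (e y - 1) * dkernel y = e (A0%:R * y) * (e (L%:R * y) - 1).
  rewrite !e_muln subrX1 mulrCA /dkernel; congr (_ * _).
  by rewrite mulr_sumr; apply: eq_bigr => j _; rewrite e_muln exprD.
have := congr1 nm geo; rewrite !nmM nm_e mul1r !nm_e_sub1 -mulrA.
by move/(mulfI _); apply; rewrite pnatr_eq0.
Qed.

Lemma dkernel_bound y : 0 < y < 1 -> nm (dkernel y) <= y^-1 + (1 - y)^-1.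
Proof.
move=> yI; have := sin_pi_ge yI; set s := _^-1 + _ => hs.
have ks := dkernel_sin y; have le1 := sin_max (pi * (L%:R * y)).
have n0 := nm_ge0 (dkernel y).
have s0 : 0 <= s by case/andP: yI => y0 y1; rewrite addr_ge0 ?invr_ge0 ?subr_ge0 ?ltW.
have hs' : 1 <= `|sin (pi * y)| * s by apply: le_trans hs (ler_wpM2r s0 (ler_norm _)).
by apply: le_trans (ler_peMr n0 hs') _; rewrite mulrA [_ * `|_|]mulrC ks ler_piMl.
Qed.

(** After an integer shift of the summation variable the points are
    [th + i / p] with [0 <= th < 1 / p].  The two points next to an integer
    contribute at most [L] each, the others are bounded by harmonic sums
    through [dkernel_bound]. *)
Lemma sum_dkernel (p : nat) (theta : R) : prime p -> (2 < p)%N ->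
  \sum_(a : 'F_p) nm (dkernel (theta + a%:R / p%:R)) <=
    2 * L%:R + 2 * p%:R * (1 + ln p%:R).
Proof.
move=> p_pr p2; have p0 : 0 < (p%:R : R) by rewrite ltr0n prime_gt0.
have pn0 := lt0r_neq0 p0.
(* [th] is the residue of [theta] modulo [1 / p]. *)
pose s := Num.floor (p%:R * theta); pose th := theta - s%:~R / p%:R.
have th0 : 0 <= th.
  by rewrite subr_ge0 ler_pdivrMr // mulrC ge_floor.
have th1 : th < p%:R^-1.
  rewrite ltrBlDl -[X in _ + X]mul1r -mulrDl ltr_pdivlMr // mulrC.
  by have := floorD1_gt (p%:R * theta); rewrite intrD.
pose H (b : nat) := nm (dkernel (th + b%:R / p%:R)).
have -> : \sum_(a : 'F_p) nm (dkernel (theta + a%:R / p%:R)) = \sum_(b : 'F_p) H b.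
  rewrite [RHS](reindex_inj (addrI (s%:~R : 'F_p))); apply: eq_bigr => a _.
  have [k hk] := Fp_shiftP s a p_pr.
  rewrite /H; move: hk; set b := nat_of_ord _ => hk.
  rewrite -(dkernel_period (th + _) k); congr (nm (dkernel _)).
  have {}hk := congr1 (fun z : int => z%:~R : R) hk.
  rewrite !rmorphD /= rmorphM /= -!pmulrn in hk.
  have -> : theta = th + s%:~R / p%:R by rewrite /th subrK.
  rewrite -!addrA; congr (_ + _).
  by rewrite -mulrDl hk mulrDl mulfK.
rewrite sum_Fp //.
have [q pq] : exists q, p = q.+2 by exists p.-2; lia.
rewrite pq big_nat_recr //= big_ltn //.
have HL b : H b <= L%:R by apply: nm_dkernel_le.
suff hmid : \sum_(1 <= i < q.+1) H i <= 2 * p%:R * (1 + ln p%:R).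
  by have := HL 0%N; have := HL q.+1; move: hmid; rewrite pq; lra.
have -> : 2 * p%:R * (1 + ln p%:R) = p%:R * (1 + ln p%:R) + p%:R * (1 + ln p%:R) :> R by ring.
have hle : \sum_(1 <= i < q.+1) (i%:R : R)^-1 <= 1 + ln p%:R.
  have [->|q0] := posnP q; first by rewrite big_geq // addr_ge0 // ln_ge0 // ler1n; lia.
  apply: le_trans (harmonic_le _ q0) _; rewrite lerD2l ler_ln ?posrE ?ltr0n //; last by lia.
  by rewrite ler_nat; lia.
apply: (@le_trans _ _ (\sum_(1 <= i < q.+1) (p%:R * i%:R^-1 + p%:R * ((q.+1 - i)%N%:R)^-1))).
  rewrite !big_nat; apply: ler_sum => i /andP[i0 iq].
  have i0R : 0 < (i%:R : R) by rewrite ltr0n.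
  have iqR : 0 < ((q.+1 - i)%N%:R : R) by rewrite ltr0n subn_gt0.
  have y1 : i%:R / p%:R <= th + i%:R / p%:R by rewrite lerDr.
  have y2 : (q.+1 - i)%N%:R / p%:R <= 1 - (th + i%:R / p%:R).
    rewrite natrB; last by rewrite ltnW.
    have -> : (q.+1%:R : R) = p%:R - 1 by rewrite pq -[q.+2%:R]natr1 addrK.
    by rewrite mulrBl mulrBl mulfV // mul1r; move: th1; lra.
  have y1' : 0 < i%:R / p%:R :> R by rewrite divr_gt0.
  have y2' : 0 < (q.+1 - i)%N%:R / p%:R :> R by rewrite divr_gt0.
  apply: le_trans (dkernel_bound _) _; first by apply/andP; split; lra.
  have -> : p%:R * (i%:R : R)^-1 = (i%:R / p%:R)^-1 by rewrite invf_div.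
  have -> : p%:R * ((q.+1 - i)%N%:R : R)^-1 = ((q.+1 - i)%N%:R / p%:R)^-1 by rewrite invf_div.
  by apply: lerD; rewrite lef_pV2 ?posrE //; lra.
rewrite big_split /= -!mulr_sumr; apply: lerD; first by rewrite ler_wpM2l // ltW.
apply: ler_wpM2l; first exact: ltW.
rewrite big_nat_rev /= (eq_big_nat _ _ (F2 := fun i => (i%:R : R)^-1)) //.
by move=> i /andP[i0 iq]; congr ((_%:R)^-1); lia.
Qed.
End Kernel.

(** * Gauss sums *)

Section Gauss.
Variables (R : realType) (p : nat) (X : 'F_p -> R[i]).
Local Notation nm := (@ComplexField.Normc.normc R).
Hypothesis p_pr : prime p.
Hypothesis p_gt2 : (2 < p)%N.
Hypothesis XM : {morph X : x y / x * y}.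
Hypothesis X1 : X 1 = 1.
Hypothesis X0 : X 0 = 0.
Hypothesis X_nontriv : exists2 u, u != 0 & X u != 1.

Let p0 : (p%:R : R) != 0.
Proof. by rewrite pnatr_eq0; lia. Qed.

Definition add_char (a : 'F_p) : R[i] := e ((a : nat)%:R / p%:R).

Lemma add_char_int (n : int) : e (n%:~R / p%:R : R) = add_char n%:~R.
Proof.
have [k hk] := Fp_intP n p_pr; move: hk; rewrite /add_char; set b := nat_of_ord _ => ->.
by rewrite rmorphD rmorphM /= mulrDl mulfK // eD e_int mulr1.
Qed.

Lemma add_char_nat n : e (n%:R / p%:R : R) = add_char n%:R.
Proof. by have := add_char_int n; rewrite -!pmulrn. Qed.

Lemma add_charD a b : add_char (a + b) = add_char a * add_char b.
Proof.
by rewrite -{1}(natr_Zp a) -{1}(natr_Zp b) -natrD -add_char_nat natrD mulrDl eD.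
Qed.

Lemma add_char0 : add_char 0 = 1.
Proof. by rewrite /add_char mul0r e0. Qed.

Lemma add_char_neq1 a : a != 0 -> add_char a != 1.
Proof.
move=> a0; rewrite -subr_eq0 -nm_eq0 nm_e_sub1 mulf_neq0 ?pnatr_eq0 // normr_eq0.
apply: lt0r_neq0; apply: sin_gt0_pi; have pi0 := pi_gt0 R.
have ap : (a < p)%N by have := ltn_ord a; rewrite [X in (_ < X)%N]Fp_cast.
have pp : 0 < (p%:R : R) by rewrite ltr0n prime_gt0.
have an0 : (0 < a)%N by rewrite lt0n; apply: contraNneq a0 => a0; apply/eqP/val_inj.
apply/andP; split; first by rewrite mulr_gt0 // divr_gt0 // ltr0n.
by rewrite mulrA ltr_pdivrMr // ltr_pM2l // ltr_nat.
Qed.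

Lemma sum_add_char c : \sum_n add_char (c * n) = if c == 0 then p%:R else 0.
Proof.
case: eqP => [->|/eqP c0].
  under eq_bigr do rewrite mul0r add_char0.
  by rewrite sumr_const card_Fp.
have E : add_char c * (\sum_n add_char (c * n)) = \sum_n add_char (c * n).
  rewrite mulr_sumr [RHS](reindex_inj (addrI 1)); apply: eq_bigr => n _.
  by rewrite mulrDr mulr1 add_charD.
move/eqP: E; rewrite -subr_eq0 -{2}[\sum_n _]mul1r -mulrBl mulf_eq0 subr_eq0.
by rewrite (negPf (add_char_neq1 c0)) => /eqP.
Qed.

Lemma X_neq0 a : a != 0 -> X a != 0.
Proof.
move=> a0; apply: contraTneq (oner_neq0 (R[i])) => Xa0.
by rewrite -X1 -(mulfV a0) XM Xa0 mul0r eqxx.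
Qed.

Lemma XV a : a != 0 -> X a^-1 = (X a)^-1.
Proof.
move=> a0; apply: (mulfI (X_neq0 a0)); rewrite -XM mulfV // X1 mulfV ?X_neq0 //.
Qed.

Lemma nm_X a : a != 0 -> nm (X a) = 1.
Proof. by move=> a0; apply: complexI; rewrite -nmE (norm_chi p_pr p_gt2 XM X1 a0). Qed.

Lemma nm_X_le1 a : nm (X a) <= 1.
Proof. by have [->|a0] := eqVneq a 0; rewrite ?X0 ?nm0 ?ler01 // nm_X. Qed.

Lemma sum_X : \sum_a X a = 0.
Proof. exact: (sum_chi XM X_nontriv). Qed.

Lemma sum_XV : \sum_a X a^-1 = 0.
Proof. by rewrite -[RHS]sum_X [RHS](reindex_inj (@invr_inj _)). Qed.

(** Gauss sum of the conjugate character; the inverse of [0] is [0], where [X]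
    vanishes, so that [X a^-1] is the conjugate of [X a] for every [a]. *)
Definition gauss_tau := \sum_a X a^-1 * add_char a.

Lemma gauss_sum n : \sum_a X a^-1 * add_char (a * n) = X n * gauss_tau.
Proof.
have [->|n0] := eqVneq n 0.
  rewrite X0 mul0r -[RHS]sum_XV; apply: eq_bigr => a _.
  by rewrite mulr0 add_char0 mulr1.
rewrite /gauss_tau mulr_sumr (reindex_inj (mulIf (invr_neq0 n0))); apply: eq_bigr => a _.
by rewrite mulfVK // invfM invrK XM [X a^-1 * _]mulrC mulrA.
Qed.

Definition gauss_tau_conj := \sum_a X a * add_char (- a).

Lemma gauss_sum' n : \sum_a X a * add_char (- (a * n)) = X n^-1 * gauss_tau_conj.
Proof.
have [->|n0] := eqVneq n 0.
  rewrite invr0 X0 mul0r -[RHS]sum_X; apply: eq_bigr => a _.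
  by rewrite mulr0 oppr0 add_char0 mulr1.
rewrite /gauss_tau_conj mulr_sumr (reindex_inj (mulIf (invr_neq0 n0))); apply: eq_bigr => a _.
by rewrite mulfVK // XM [X a * _]mulrC mulrA.
Qed.

Lemma sum_XXV : \sum_a X a * X a^-1 = (p.-1)%:R.
Proof.
rewrite (bigD1 0) //= X0 mul0r add0r (eq_bigr (fun=> 1)) => [|a a0].
  rewrite sumr_const; congr (_%:R); rewrite -[in RHS](card_Fp p_pr) -(cardC1 (0 : 'F_p)).
  by apply: eq_card => x; rewrite !inE.
by rewrite -XM mulfV.
Qed.

(** Parseval: the sum over [n] of [gauss_sum n * gauss_sum' n] is evaluated once
    by these formulas and once by orthogonality of additive characters. *)
Lemma gauss_tau_tau_conj : gauss_tau * gauss_tau_conj = p%:R.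
Proof.
have q0 : (p.-1%:R : R[i]) != 0 by rewrite pnatr_eq0; lia.
apply: (mulfI q0).
transitivity (\sum_n (X n * gauss_tau) * (X n^-1 * gauss_tau_conj)).
  by rewrite -sum_XXV mulr_suml; apply: eq_bigr => n _; ring.
under eq_bigr => n _.
  rewrite -gauss_sum -gauss_sum' mulr_suml.
  under eq_bigr => a _ do rewrite mulr_sumr.
  over.
rewrite exchange_big -sum_XXV mulr_suml; apply: eq_bigr => a _.
rewrite exchange_big (bigD1 a) //= [X in _ + X]big1 ?addr0 => [|b ba].
  rewrite (eq_bigr (fun=> X a * X a^-1)) => [|n _].
    by rewrite sumr_const card_Fp // mulr_natr.
  by rewrite mulrACA -add_charD subrr add_char0 mulr1 mulrC.
transitivity (X a^-1 * X b * \sum_n add_char ((a - b) * n)).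
  rewrite mulr_sumr; apply: eq_bigr => n _.
  by rewrite mulrACA -add_charD mulrBl.
by rewrite sum_add_char subr_eq0 eq_sym (negPf ba) mulr0.
Qed.

Lemma nm_conj (z : R[i]) : nm (conjc z) = nm z.
Proof. by case: z => a b; rewrite /= sqrrN. Qed.

Lemma mul_conj (z : R[i]) : nm z = 1 -> z * conjc z = 1.
Proof.
move=> z1; rewrite -sqr_normc nmE z1; by rewrite expr1n.
Qed.

Lemma conj_X a : conjc (X a) = X a^-1.
Proof.
have [->|a0] := eqVneq a 0; first by rewrite invr0 X0 conjc0.
rewrite XV //; apply: (mulfI (X_neq0 a0)).
by rewrite mul_conj ?nm_X // mulfV ?X_neq0.
Qed.

Lemma conj_add_char a : conjc (add_char a) = add_char (- a).
Proof.
have : add_char a * add_char (- a) = 1 by rewrite -add_charD subrr add_char0.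
have : add_char a * conjc (add_char a) = 1 by rewrite mul_conj ?nm_e.
have p0' : add_char a != 0 by rewrite -nm_eq0 nm_e oner_neq0.
by move=> E1 E2; apply: (mulfI p0'); rewrite E1 E2.
Qed.

Lemma nm_gauss_tau : nm gauss_tau = Num.sqrt p%:R.
Proof.
have E : gauss_tau_conj = conjc gauss_tau.
  apply: esym; rewrite /gauss_tau.
  transitivity (\sum_a conjc (X a^-1 * add_char a)); first by apply: rmorph_sum.
  apply: eq_bigr => a _; transitivity (conjc (X a^-1) * conjc (add_char a)).
    by apply: rmorphM.
  by rewrite conj_X conj_add_char invrK.
have := congr1 nm gauss_tau_tau_conj; rewrite nmM E nm_conj nm_nat -expr2 => <-.
by rewrite sqrtr_sqr ger0_norm ?nm_ge0.
Qed.

Variables (A0 L : nat).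

Definition Fsum (theta : R) : R[i] :=
  \sum_(j < L) X (A0 + j)%:R * e ((A0 + j)%:R * theta).

Lemma gauss_tau_Fsum theta :
  gauss_tau * Fsum theta = \sum_(a : 'F_p) X a^-1 * dkernel A0 L (theta + (a : nat)%:R / p%:R).
Proof.
rewrite /Fsum mulr_sumr; under [RHS]eq_bigr => a _ do rewrite /dkernel mulr_sumr.
rewrite [RHS]exchange_big /=; apply: eq_bigr => j _.
rewrite mulrA [gauss_tau * _]mulrC -gauss_sum mulr_suml; apply: eq_bigr => a _.
rewrite -mulrA; congr (_ * _); rewrite mulrDr eD mulrC; congr (_ * _).
by rewrite -{1}(natr_Zp a) -natrM -add_char_nat natrM [a%:R * _]mulrC mulrA.
Qed.

(** Translating [theta] by [k / p] amounts to shifting the character by [k],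
    which is what makes averages over [k] accessible to correlation bounds. *)
Lemma gauss_tau_Fsum_shift (theta : R) (k : 'F_p) :
  gauss_tau * Fsum (theta - (k : nat)%:R / p%:R) =
  \sum_(m : 'F_p) X (k + m)^-1 * dkernel A0 L (theta + (m : nat)%:R / p%:R).
Proof.
rewrite gauss_tau_Fsum (reindex_inj (addrI k)); apply: eq_bigr => m _; congr (_ * _).
have [j] := Fp_shiftP (k : nat)%:Z m p_pr; rewrite -pmulrn natr_Zp.
set b := nat_of_ord (k + m) => hj.
have {}hj := congr1 (fun z : int => z%:~R : R) hj.
rewrite !rmorphD /= rmorphM /= -!pmulrn in hj.
rewrite -(dkernel_period _ _ _ j); congr dkernel; rewrite -!addrA; congr (_ + _).
have -> : m%:R = b%:R + j%:~R * p%:R - k%:R :> R by rewrite -hj addrC addKr.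
by rewrite mulrBl mulrDl mulfK // addrC -addrA addrA.
Qed.

Lemma nm_Fsum_le theta :
  Num.sqrt p%:R * nm (Fsum theta) <= 2 * L%:R + 2 * p%:R * (1 + ln p%:R).
Proof.
rewrite -nm_gauss_tau -nmM gauss_tau_Fsum; apply: le_trans (nm_sum _ _ _) _.
apply: le_trans (sum_dkernel A0 L theta p_pr p_gt2); apply: ler_sum => a _.
by rewrite nmM ler_piMl ?nm_ge0 ?nm_X_le1.
Qed.
End Gauss.

(** * Riesz products of shifted characters *)

Section Riesz.
Variables (R : realType) (p : nat) (X : 'F_p -> R[i]).
Local Notation nm := (@ComplexField.Normc.normc R).
Hypothesis p_pr : prime p.
Hypothesis p_gt2 : (2 < p)%N.
Hypothesis XM : {morph X : x y / x * y}.
Hypothesis X1 : X 1 = 1.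
Hypothesis X0 : X 0 = 0.
Hypothesis X_nontriv : exists2 u, u != 0 & X u != 1.
Variables (y : R) (y0 : 0 <= y) (y3 : y ^+ 3 = p%:R ^+ 2).
Variables (eps : 'F_p -> R) (eps1 : forall m, `|eps m| <= 1).

(** Conjugation of the character is thus an exponent [p - 2], which is prime to
    [p - 1] and fits the exponents of [weil_bound]. *)
Lemma Fp_invE (x : 'F_p) : x^-1 = x ^+ p.-2.
Proof.
have [->|x0] := eqVneq x 0; first by rewrite invr0 expr0n; have -> : (p.-2 == 0)%N = false by lia.
apply: (mulfI x0); rewrite mulfV // -exprS.
have -> : p.-2.+1 = p.-1 by lia.
by rewrite Fp_fermat.
Qed.

Lemma coprime_pred2 : coprime p.-2 p.-1.
Proof.
have -> : p.-1 = p.-2.+1 by lia.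
exact: coprimenS.
Qed.

Definition char_shifts (e : 'F_p -> nat) (k : 'F_p) : R[i] := X (\prod_a (k + a) ^+ e a).

Definition set_exp (e : 'F_p -> nat) m g := fun a => if a == m then g else e a.

Lemma char_shifts_set_exp e m g k : e m = 0%N ->
  char_shifts (set_exp e m g) k = char_shifts e k * X ((k + m) ^+ g).
Proof.
move=> em; rewrite /char_shifts -XM mulrC (bigD1 m) //= [in RHS](bigD1 m) //= em expr0 mul1r.
rewrite /set_exp eqxx; congr (X (_ * _)); apply: eq_bigr => a /negPf am.
by rewrite am.
Qed.

Lemma card_set_exp e m g : (#|[set a | set_exp e m g a != 0%N]| <= #|[set a | e a != 0%N]|.+1)%N.
Proof.
apply: leq_trans (_ : #|m |: [set a | e a != 0%N]| <= _)%N; last first.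
  by rewrite cardsU1 -[X in (_ <= X)%N]add1n leq_add2r leq_b1.
apply: subset_leq_card; apply/fintype.subsetP => a; rewrite !inE /set_exp.
by case: (a == m).
Qed.

Definition riesz_factor (m k : 'F_p) : R[i] := 1 + (eps m)%:C * ((X (k + m) + X (k + m)^-1) / 2).

(** The exponents [e] carry the factors of the Riesz product that have already
    been expanded. *)
Definition riesz_sum (S : seq 'F_p) (e : 'F_p -> nat) :=
  \sum_k char_shifts e k * \prod_(m <- S) riesz_factor m k.

(** Expanding the factor at [m] gives the term [1] and the terms [X] and its
    conjugate, that is, the exponents [1] and [p - 2] at [m]. *)
Lemma riesz_sum_cons m S e : e m = 0%N ->
  riesz_sum (m :: S) e =
  riesz_sum S e + (eps m)%:C / 2 * (riesz_sum S (set_exp e m 1) + riesz_sum S (set_exp e m p.-2)).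
Proof.
move=> em; rewrite /riesz_sum -big_split mulr_sumr -big_split; apply: eq_bigr => k _ /=.
by rewrite big_cons !char_shifts_set_exp // expr1 -Fp_invE /riesz_factor; ring.
Qed.

Let J (e : 'F_p -> nat) := #|[set a | e a != 0%N]|.

Lemma nm_half_eps m (z1 z2 : R[i]) (B : R) : nm z1 <= B -> nm z2 <= B ->
  nm ((eps m)%:C / 2 * (z1 + z2)) <= B.
Proof.
move=> h1 h2; rewrite nmM nmM ComplexField.Normc.normcV nm_nat.
have -> : nm (eps m)%:C = `|eps m| by rewrite /= expr0n addr0 sqrtr_sqr.
have h : nm (z1 + z2) <= B + B by apply: le_trans (nmD _ _) (lerD h1 h2).
have n0 := nm_ge0 (z1 + z2); have := eps1 m; have e0 := normr_ge0 (eps m).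
move: (nm _) (`|eps m|) h n0 e0 => u v *; nra.
Qed.

(** Each of the [2 ^ size S] unit weights of the expansion meets [weil_bound],
    since the exponent at [a0] is never changed. *)
Lemma riesz_coprime S e a0 : uniq S -> {in S, forall m, e m = 0%N} ->
  coprime (e a0) p.-1 -> nm (riesz_sum S e) <= 2 ^+ size S * ((size S + J e)%:R * y).
Proof.
elim: S e => [|m S IH] e /=.
  move=> _ _ co; rewrite expr0 mul1r add0n /riesz_sum.
  under eq_bigr => k _ do rewrite big_nil mulr1.
  exact: (weil_bound p_pr p_gt2 XM X1 X0 X_nontriv co y0 y3).
move=> /andP[mS uS] eS co; have em : e m = 0%N by rewrite eS ?mem_head.
have eS' : {in S, forall m, e m = 0%N} by move=> a aS; rewrite eS // inE aS orbT.
have a0m : a0 != m.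
  by apply: contraTneq co => ->; rewrite em /coprime gcd0n; lia.
rewrite riesz_sum_cons //; apply: le_trans (nmD _ _) _.
set B := 2 ^+ size S * ((size S + (J e).+1)%:R * y).
have hu g : nm (riesz_sum S (set_exp e m g)) <= B.
  have hco : coprime (set_exp e m g a0) p.-1 by rewrite /set_exp (negPf a0m).
  apply: le_trans (IH _ uS _ hco) _.
    move=> a aS; rewrite /set_exp ifN ?eS' //; apply: contraNneq mS => <- //.
  rewrite ler_wpM2l ?exprn_ge0 // ler_wpM2r // ler_nat leq_add2l; exact: card_set_exp.
have hZ : nm (riesz_sum S e) <= B.
  apply: le_trans (IH _ uS eS' co) _.
  by rewrite ler_wpM2l ?exprn_ge0 // ler_wpM2r // ler_nat leq_add2l.
apply: le_trans (lerD hZ (nm_half_eps _ (hu _) (hu _))) _.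
by rewrite /B exprS addSnnS; lra.
Qed.

(** Every term of the expansion other than the constant one contains a shift with
    exponent [1] or [p - 2]. *)
Lemma riesz_diff S e : uniq S -> {in S, forall m, e m = 0%N} ->
  nm (riesz_sum S e - \sum_k char_shifts e k) <= 2 ^+ size S * ((size S + J e)%:R * y).
Proof.
elim: S e => [|m S IH] e /=.
  move=> _ _; have -> : riesz_sum [::] e = \sum_k char_shifts e k.
    by apply: eq_bigr => k _; rewrite big_nil mulr1.
  by rewrite subrr nm0 !mulr_ge0 ?exprn_ge0.
move=> /andP[mS uS] eS; have em : e m = 0%N by rewrite eS ?mem_head.
have eS' : {in S, forall m, e m = 0%N} by move=> a aS; rewrite eS // inE aS orbT.
rewrite riesz_sum_cons // addrAC; apply: le_trans (nmD _ _) _.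
set B := 2 ^+ size S * ((size S + (J e).+1)%:R * y).
have hu g : coprime g p.-1 -> nm (riesz_sum S (set_exp e m g)) <= B.
  move=> cg; have hco : coprime (set_exp e m g m) p.-1 by rewrite /set_exp eqxx.
  apply: le_trans (riesz_coprime uS _ hco) _.
    move=> a aS; rewrite /set_exp ifN ?eS' //; apply: contraNneq mS => <- //.
  rewrite ler_wpM2l ?exprn_ge0 // ler_wpM2r // ler_nat leq_add2l; exact: card_set_exp.
have hZ : nm (riesz_sum S e - \sum_k char_shifts e k) <= B.
  apply: le_trans (IH _ uS eS') _.
  by rewrite ler_wpM2l ?exprn_ge0 // ler_wpM2r // ler_nat leq_add2l.
apply: le_trans (lerD hZ (nm_half_eps _ (hu 1%N _) (hu p.-2 _))) _.
- exact: coprime1n.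
- exact: coprime_pred2.
by rewrite /B exprS addSnnS; lra.
Qed.

Variables (S : seq 'F_p) (uS : uniq S).
Let M := size S.
Definition riesz_weight k := \prod_(m <- S) riesz_factor m k.
Definition riesz_error : R := 2 ^+ M * (M.+1%:R * y).

Definition exp_at (m0 : 'F_p) g := set_exp (fun=> 0%N) m0 g.

Lemma char_shifts_exp_at m0 g k : char_shifts (exp_at m0 g) k = X ((k + m0) ^+ g).
Proof. by rewrite /exp_at char_shifts_set_exp // /char_shifts big1 ?X1 ?mul1r. Qed.

Lemma card_exp_at m0 g : (J (exp_at m0 g) <= 1)%N.
Proof.
apply: leq_trans (card_set_exp _ _ _) _; rewrite ltnS eq_card0 // => a.
by rewrite !inE.
Qed.

Lemma riesz_total : nm (\sum_k riesz_weight k - p%:R) <= riesz_error.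
Proof.
have W0 k : char_shifts (fun=> 0%N) k = 1 by rewrite /char_shifts big1.
have := @riesz_diff S (fun=> 0%N) uS (fun _ _ => erefl).
have -> : riesz_sum S (fun=> 0%N) = \sum_k riesz_weight k by apply: eq_bigr => k _; rewrite
  W0 mul1r.
under [X in _ - X]eq_bigr => k _ do rewrite W0.
rewrite sumr_const card_Fp //; move/le_trans; apply; rewrite /riesz_error ler_wpM2l ?exprn_ge0 //.
rewrite ler_wpM2r // ler_nat -[M.+1]addn1 leq_add2l.
by rewrite /J eq_card0 // => a; rewrite !inE.
Qed.

Lemma riesz_notin m0 : m0 \notin S -> nm (\sum_k riesz_weight k * X (k + m0)^-1) <= riesz_error.
Proof.
move=> m0S; have co : coprime (exp_at m0 p.-2 m0) p.-1.
  by rewrite /exp_at /set_exp eqxx coprime_pred2.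
have := @riesz_coprime S (exp_at m0 p.-2) m0 uS _ co.
have -> : riesz_sum S (exp_at m0 p.-2) = \sum_k riesz_weight k * X (k + m0)^-1.
  by apply: eq_bigr => k _; rewrite char_shifts_exp_at -Fp_invE mulrC.
move=> h; apply: le_trans (h _) _.
  by move=> a aS; rewrite /exp_at /set_exp ifN //; apply: contraNneq m0S => <-.
rewrite /riesz_error ler_wpM2l ?exprn_ge0 // ler_wpM2r // ler_nat -[M.+1]addn1 leq_add2l.
exact: card_exp_at.
Qed.

(** The value of the sum of [Re (X k) * X k^-1]: the diagonal contribution to the
    correlation of the Riesz product with a conjugate character.  It is
    [(p - 1) / 2], or [p - 1] if [X] is quadratic. *)
Definition riesz_mean : R[i] := (\sum_k X k * X k^-1 + \sum_k X k^-1 * X k^-1) / 2.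

Lemma riesz_mean_real : exists2 kap : R, riesz_mean = kap%:C & (p.-1)%:R / 2 <= kap.
Proof.
rewrite /riesz_mean (sum_XXV p_pr XM X1 X0).
have E : \sum_k X k^-1 * X k^-1 = \sum_k X (k * k).
  by rewrite [RHS](reindex_inj (@invr_inj _)); apply: eq_bigr => k _; rewrite XM.
have [triv|] := boolP [forall u, (u != 0) ==> (X (u * u) == 1)]; last first.
  rewrite negb_forall => /existsP[u]; rewrite negb_imply => /andP[u0 Xu].
  exists ((p.-1)%:R / 2) => //.
  have -> : \sum_k X k^-1 * X k^-1 = 0.
    rewrite E; apply: (@sum_char_mul p _ (fun k => X (k * k)) u u0 _ _) => //.
    by move=> a b; rewrite -XM; congr X; ring.
  by rewrite addr0 rmorphM fmorphV !rmorph_nat.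
exists (p.-1)%:R; last by rewrite ler_pdivrMr // ler_peMr // ler1n.
have -> : \sum_k X k^-1 * X k^-1 = (p.-1)%:R.
  rewrite E -(sum_XXV p_pr XM X1 X0); apply: eq_bigr => k _.
  have [->|k0] := eqVneq k 0; first by rewrite mulr0 X0 mul0r.
  move/forallP: triv => /(_ k); rewrite k0 /= => /eqP ->.
  by rewrite -XM mulfV.
by rewrite -mulr2n -[X in X / 2]mulr_natr mulfK ?pnatr_eq0 // rmorph_nat.
Qed.

(** The factor at [m0] times [X (k + m0)^-1] has the exponents [p - 2], [p - 1] and
    [2 (p - 2)] at [m0].  Against the remaining factors each of them is
    reduced to its plain sum by [riesz_diff]; the first plain sum vanishes
    and the other two make up [riesz_mean]. *)
Lemma riesz_in m0 : m0 \in S ->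
  nm (\sum_k riesz_weight k * X (k + m0)^-1 - (eps m0)%:C * riesz_mean) <= riesz_error.
Proof.
move=> m0S; pose S' := rem m0 S.
have uS' : uniq S' by apply: rem_uniq.
have m0S' : m0 \notin S' by rewrite /S' mem_rem_uniq // inE eqxx.
have szS' : M = (size S').+1.
  rewrite /M /S' size_rem // prednK //; by case: S m0S.
have RzE k : riesz_weight k = riesz_factor m0 k * \prod_(m <- S') riesz_factor m k by rewrite
  /riesz_weight (big_rem m0).
have in0 g : {in S', forall m, exp_at m0 g m = 0%N}.
  by move=> a aS; rewrite /exp_at /set_exp ifN //; apply: contraNneq m0S' => <-.
pose B := 2 ^+ size S' * ((size S').+1%:R * y).
have dif g : nm (riesz_sum S' (exp_at m0 g) - \sum_k char_shifts (exp_at m0 g) k) <= B.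
  apply: le_trans (riesz_diff uS' (in0 g)) _.
  rewrite ler_wpM2l ?exprn_ge0 // ler_wpM2r // ler_nat -[(size S').+1]addn1 leq_add2l.
  exact: card_exp_at.
have W1 k : char_shifts (exp_at m0 p.-2) k = X (k + m0)^-1 by rewrite char_shifts_exp_at -Fp_invE.
have W2 k : char_shifts (exp_at m0 p.-1) k = X (k + m0) * X (k + m0)^-1.
  by rewrite char_shifts_exp_at Fp_invE -XM -exprS; congr (X (_ ^+ _)); lia.
have W3 k : char_shifts (exp_at m0 (p.-2 + p.-2)) k = X (k + m0)^-1 * X (k + m0)^-1.
  by rewrite char_shifts_exp_at Fp_invE -XM exprD.
have sh (f : 'F_p -> R[i]) : \sum_k f (k + m0) = \sum_k f k.
  by rewrite [RHS](reindex_inj (addIr m0)).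
have -> : \sum_k riesz_weight k * X (k + m0)^-1 - (eps m0)%:C * riesz_mean =
  (riesz_sum S' (exp_at m0 p.-2) - \sum_k char_shifts (exp_at m0 p.-2) k) + (eps m0)%:C / 2 *
  ((riesz_sum S' (exp_at m0 p.-1) - \sum_k char_shifts (exp_at m0 p.-1) k) +
   (riesz_sum S' (exp_at m0 (p.-2 + p.-2)) - \sum_k char_shifts (exp_at m0 (p.-2 + p.-2)) k)).
  have -> : \sum_k char_shifts (exp_at m0 p.-2) k = 0.
    under eq_bigr => k _ do rewrite W1.
    by rewrite (sh (fun k => X k^-1)) (sum_XV XM X_nontriv).
  rewrite (eq_bigr _ (fun k _ => W2 k)) (eq_bigr _ (fun k _ => W3 k)).
  rewrite (sh (fun k => X k * X k^-1)) (sh (fun k => X k^-1 * X k^-1)) /riesz_mean.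
  set k1 := \sum_k (X k * X k^-1); set k2 := \sum_k (X k^-1 * X k^-1).
  have -> : \sum_k riesz_weight k * X (k + m0)^-1 = riesz_sum S' (exp_at m0 p.-2) + (eps
    m0)%:C / 2 *
     (riesz_sum S' (exp_at m0 p.-1) + riesz_sum S' (exp_at m0 (p.-2 + p.-2))).
    rewrite /riesz_sum -big_split mulr_sumr -big_split; apply: eq_bigr => k _ /=.
    by rewrite W1 W2 W3 RzE /riesz_factor; ring.
  by ring.
apply: le_trans (nmD _ _) _.
apply: le_trans (lerD (dif _) (nm_half_eps _ (dif _) (dif _))) _.
rewrite /riesz_error szS' exprS.
have : B <= 2 ^+ size S' * ((size S').+2%:R * y).
  by rewrite /B ler_wpM2l ?exprn_ge0 // ler_wpM2r // ler_nat.
by rewrite -[2 * _ * _]mulrA; move: (2 ^+ size S' * (_ * _)) => c; lra.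
Qed.
End Riesz.

(** * The lower bound for the maximum *)

Section Lower.
Variables (R : realType) (p : nat) (X : 'F_p -> R[i]).
Local Notation nm := (@ComplexField.Normc.normc R).
Hypothesis p_pr : prime p.
Hypothesis p_gt2 : (2 < p)%N.
Hypothesis XM : {morph X : x y / x * y}.
Hypothesis X1 : X 1 = 1.
Hypothesis X0 : X 0 = 0.
Hypothesis X_nontriv : exists2 u, u != 0 & X u != 1.

Lemma nm_real (x : R) : nm x%:C = `|x|.
Proof. by rewrite /= expr0n addr0 sqrtr_sqr. Qed.

Lemma riesz_factor_real (eps : 'F_p -> R) m k : `|eps m| <= 1 ->
  exists2 r : R, riesz_factor X eps m k = r%:C & 0 <= r.
Proof.
move=> e1; exists (1 + eps m * complex.Re (X (k + m))).
  rewrite /riesz_factor -(conj_X p_pr p_gt2 XM X1 X0) addcJ mulrAC mulfV ?pnatr_eq0 // mul1r.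
  by rewrite rmorphD rmorphM rmorph1.
have le : `|complex.Re (X (k + m))| <= 1.
  apply: le_trans (nm_X_le1 p_pr p_gt2 XM X1 X0 (k + m)).
  by rewrite -lecR -nmE normc_ge_Re.
have := ler_normr (- (eps m * complex.Re (X (k + m)))) 0.
have : `|eps m * complex.Re (X (k + m))| <= 1 by rewrite normrM mulr_ile1.
by rewrite ler_norml; lra.
Qed.

(** The Riesz product is a nonnegative real number, so no absolute value is lost
    in the sum. *)
Lemma sum_riesz_weight_nm (eps : 'F_p -> R) (S : seq 'F_p) : (forall m, `|eps m| <= 1) ->
  \sum_k nm (riesz_weight X eps S k) = nm (\sum_k riesz_weight X eps S k).
Proof.
move=> e1; have real k : exists2 r : R, riesz_weight X eps S k = r%:C & 0 <= r.
  rewrite /riesz_weight; elim: S => [|m S [r rE r0]].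
    by exists 1; rewrite ?big_nil.
  have [r' r'E r'0] := riesz_factor_real k (e1 m).
  by exists (r' * r); rewrite ?mulr_ge0 // big_cons rE r'E rmorphM.
have nmR k : (nm (riesz_weight X eps S k))%:C = riesz_weight X eps S k.
  by have [r -> r0] := real k; rewrite nm_real ger0_norm.
have -> : \sum_k riesz_weight X eps S k = (\sum_k nm (riesz_weight X eps S k))%:C.
  by rewrite rmorph_sum; apply: eq_bigr => k _; rewrite -[LHS]nmR.
by rewrite nm_real ger0_norm // sumr_ge0 // => k _; apply: nm_ge0.
Qed.

Variables (y : R) (y0 : 0 <= y) (y3 : y ^+ 3 = p%:R ^+ 2).
Variables (A0 L : nat) (Mx : R).
Hypothesis F_le : forall theta, nm (Fsum X A0 L theta) <= Mx.

(** The average [T] of [gauss_tau * Fsum] against the Riesz product is at most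
    [sqrt p * Mx] times the total weight.  By [gauss_tau_Fsum_shift] it is
    also a combination of kernel values [K m] with coefficients [Cm m], known
    up to [riesz_error] from [riesz_in] and [riesz_notin]. *)
Lemma kernel_sum_le_max (eps : 'F_p -> R) (S : seq 'F_p) (theta : R)
    (K := fun m : 'F_p => dkernel A0 L (theta + (m : nat)%:R / p%:R)) : uniq S ->
  (forall m, `|eps m| <= 1) ->
  (p.-1)%:R / 2 * nm (\sum_(m <- S) (eps m)%:C * K m) <=
  Num.sqrt p%:R * Mx * (p%:R + riesz_error y S) + riesz_error y S * \sum_m nm (K m).
Proof.
move=> uS e1; set E := riesz_error y S.
have Mx0 : 0 <= Mx by apply: le_trans (nm_ge0 _) (F_le 0).
pose T := \sum_k riesz_weight X eps S k * (gauss_tau X * Fsum X A0 L (theta - (k : nat)%:R /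
  p%:R)).
have nmT : nm T <= Num.sqrt p%:R * Mx * (p%:R + E).
  apply: le_trans (nm_sum _ _ _) _.
  apply: (@le_trans _ _ (\sum_k nm (riesz_weight X eps S k) * (Num.sqrt p%:R * Mx))).
    apply: ler_sum => k _; rewrite !nmM ler_wpM2l ?nm_ge0 //.
    by rewrite (nm_gauss_tau p_pr p_gt2 XM X1 X0 X_nontriv) ler_wpM2l ?sqrtr_ge0.
  rewrite -mulr_suml mulrC ler_wpM2l ?mulr_ge0 ?sqrtr_ge0 // sum_riesz_weight_nm //.
  have tot := riesz_total p_pr p_gt2 XM X1 X0 X_nontriv y0 y3 e1 uS.
  rewrite -[X in nm X](subrK p%:R) addrC [leRHS]addrC; apply: le_trans (nmD _ _) _.
  by rewrite nm_nat [leRHS]addrC lerD2l.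
pose Cm m := \sum_k riesz_weight X eps S k * X (k + m)^-1.
have TE : T = \sum_m K m * Cm m.
  rewrite /T; under eq_bigr => k _ do
    rewrite (gauss_tau_Fsum_shift p_pr p_gt2 XM X0 X_nontriv) mulr_sumr.
  rewrite exchange_big; apply: eq_bigr => m _; rewrite mulr_sumr.
  by apply: eq_bigr => k _; rewrite /K; ring.
have [kap kapE kapge] := riesz_mean_real p_pr XM X1 X0.
have split : kap%:C * (\sum_(m <- S) (eps m)%:C * K m) =
    T - \sum_m K m * (Cm m - (if m \in S then (eps m)%:C * kap%:C else 0)).
  rewrite TE -sumrB (big_uniq _ uS) /= mulr_sumr big_mkcond.
  by apply: eq_bigr => m _; case: ifP => _; ring.
have kap0 : 0 <= kap by apply: le_trans kapge; rewrite divr_ge0.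
apply: (@le_trans _ _ (kap * nm (\sum_(m <- S) (eps m)%:C * K m))).
  by rewrite ler_wpM2r ?nm_ge0.
have -> : kap * nm (\sum_(m <- S) (eps m)%:C * K m) = nm (kap%:C * (\sum_(m <- S) (eps m)%:C
  * K m)).
  by rewrite nmM nm_real ger0_norm.
rewrite split; apply: le_trans (nmD _ _) _; apply: lerD => //.
rewrite nmN; apply: le_trans (nm_sum _ _ _) _; rewrite mulr_sumr; apply: ler_sum => m _.
rewrite nmM mulrC ler_wpM2r ?nm_ge0 //; case: ifPn => mS.
  by rewrite -kapE; apply: (riesz_in p_pr p_gt2 XM X1 X0 X_nontriv).
by rewrite subr0; apply: (riesz_notin p_pr p_gt2 XM X1 X0 X_nontriv).
Qed.

(** One of the sums of the real or of the imaginary parts in absolute value is at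
    least half of the sum of the norms; take the signs of those parts.  The
    signs must be real, as [Re (X k)] is what the Riesz product contains. *)
Lemma sign_choice (S : seq 'F_p) (K : 'F_p -> R[i]) :
  exists2 eps : 'F_p -> R, (forall m, `|eps m| <= 1) &
    (\sum_(m <- S) nm (K m)) / 2 <= nm (\sum_(m <- S) (eps m)%:C * K m).
Proof.
have sg1 (x : R) : `|Num.sg x| <= 1 by rewrite normr_sg; case: (x == 0); rewrite ?ler01.
have nm_le_ReIm z : nm z <= `|complex.Re z| + `|complex.Im z|.
  case: z => a b /=; rewrite -[leRHS]ger0_norm ?addr_ge0 // -sqrtr_sqr ler_wsqrtr //.
  rewrite sqrrD -[a ^+ 2]real_normK ?num_real // -[b ^+ 2]real_normK ?num_real //.
  by have := normr_ge0 a; have := normr_ge0 b; nra.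
have le1 : \sum_(m <- S) nm (K m) <=
    \sum_(m <- S) `|complex.Re (K m)| + \sum_(m <- S) `|complex.Im (K m)|.
  by rewrite -big_split; apply: ler_sum.
have ReM (c : R) (z : R[i]) : complex.Re (c%:C * z) = c * complex.Re z.
  by case: z => a b /=; rewrite mul0r subr0.
have ImM (c : R) (z : R[i]) : complex.Im (c%:C * z) = c * complex.Im z.
  by case: z => a b /=; rewrite mul0r addr0.
have Re_sum (f : 'F_p -> R[i]) : complex.Re (\sum_(m <- S) f m) = \sum_(m <- S) complex.Re (f m).
  by rewrite (big_morph (@complex.Re R) (id1 := 0) (op1 := +%R)) // => [[a b] [c d]].
have Im_sum (f : 'F_p -> R[i]) : complex.Im (\sum_(m <- S) f m) = \sum_(m <- S) complex.Im (f m).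
  by rewrite (big_morph (@complex.Im R) (id1 := 0) (op1 := +%R)) // => [[a b] [c d]].
have Re_le z : complex.Re z <= nm z.
  by apply: le_trans (ler_norm _) _; rewrite -lecR -nmE normc_ge_Re.
have Im_le z : complex.Im z <= nm z.
  case: z => a b /=; apply: le_trans (ler_norm _) _; rewrite -sqrtr_sqr ler_wsqrtr //.
  by rewrite lerDr sqr_ge0.
have [h|h] := leP (\sum_(m <- S) nm (K m) / 2) (\sum_(m <- S) `|complex.Re (K m)|).
  exists (fun m => Num.sg (complex.Re (K m))) => [m|]; first exact: sg1.
  apply: le_trans (Re_le _); rewrite Re_sum mulr_suml; apply: le_trans h _.
  by rewrite le_eqVlt; apply/orP; left; apply/eqP/eq_bigr => m _; rewrite ReM normrEsg.
exists (fun m => Num.sg (complex.Im (K m))) => [m|]; first exact: sg1.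
apply: le_trans (Im_le _); rewrite Im_sum.
have -> : \sum_(m <- S) complex.Im ((Num.sg (complex.Im (K m)))%:C * K m) =
   \sum_(m <- S) `|complex.Im (K m)|.
  by apply: eq_bigr => m _; rewrite ImM [RHS]normrEsg.
by move: h; rewrite -mulr_suml; lra.
Qed.
End Lower.

Section KernelLower.
Variables (R : realType) (A0 L : nat).
Local Notation nm := (@ComplexField.Normc.normc R).
Hypothesis L0 : (0 < L)%N.
Let h : R := (2 * L%:R)^-1.

(** The shift by [h] adds [pi / 2] to the angle [pi * L * y] in [dkernel_sin], and
    sine and cosine of an angle are not both small. *)
Lemma dkernel_pair (y : R) : 0 <= y ->
  1 <= pi * (y + h) * (nm (dkernel A0 L y) + nm (dkernel A0 L (y + h))).
Proof.
move=> y0; have LR : 0 < (L%:R : R) by rewrite ltr0n.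
have h0 : 0 < h by rewrite invr_gt0 mulr_gt0.
have pi0 := pi_gt0 R.
have k1 := dkernel_sin A0 L y; have k2 := dkernel_sin A0 L (y + h).
have n1 := nm_ge0 (dkernel A0 L y); have n2 := nm_ge0 (dkernel A0 L (y + h)).
have s1 : `|sin (pi * y)| <= pi * (y + h).
  by apply: le_trans (norm_sin_le _) _; nra.
have s2 : `|sin (pi * (y + h))| <= pi * (y + h) by apply: norm_sin_le; nra.
have E : pi * (L%:R * (y + h)) = pi * (L%:R * y) + pi / 2.
  by rewrite /h; field; rewrite pnatr_eq0 -lt0n.
rewrite E sinDpihalf in k2.
have sc : 1 <= `|sin (pi * (L%:R * y))| + `|cos (pi * (L%:R * y))|.
  have := cos2Dsin2 (pi * (L%:R * y)).
  rewrite -[cos _ ^+ 2]real_normK ?num_real // -[sin _ ^+ 2]real_normK ?num_real //.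
  have := sin_max (pi * (L%:R * y)); have := cos_max (pi * (L%:R * y)).
  have := normr_ge0 (sin (pi * (L%:R * y))); have := normr_ge0 (cos (pi * (L%:R * y))).
  by move: (`|sin _|) (`|cos _|) => a b; nra.
apply: le_trans sc _; rewrite -k1 -k2 [leRHS]mulrDr.
by apply: lerD; apply: ler_wpM2r.
Qed.

(** Summed over [i], [dkernel_pair] bounds the sum of the values for the two
    choices [0] and [h] of [theta] by a harmonic sum; keep the larger one. *)
Lemma sum_dkernel_ge (p M : nat) (t : R) : (0 < p)%N -> p%:R * h <= t ->
  exists theta : R, p%:R * ln M.+1%:R / (2 * pi * (1 + t)) <=
    \sum_(1 <= i < M.+1) nm (dkernel A0 L (theta + i%:R / p%:R)).
Proof.
move=> p0 pt; have LR : 0 < (L%:R : R) by rewrite ltr0n.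
have pR : 0 < (p%:R : R) by rewrite ltr0n.
have h0 : 0 < h by rewrite invr_gt0 mulr_gt0.
have t0 : 0 < t by apply: lt_le_trans pt; rewrite mulr_gt0.
have pi0 := pi_gt0 R.
pose s theta := \sum_(1 <= i < M.+1) nm (dkernel A0 L (theta + i%:R / p%:R)).
have tot : p%:R * ln M.+1%:R / (pi * (1 + t)) <= s 0 + s h.
  apply: (@le_trans _ _ (\sum_(1 <= i < M.+1) p%:R / (pi * (1 + t)) * (i%:R)^-1)).
    rewrite -mulr_sumr mulrAC ler_wpM2l ?harmonic_ge //.
    by rewrite divr_ge0 ?mulr_ge0 // ?ltW // addr_gt0.
  rewrite /s -big_split /= !big_nat; apply: ler_sum => i /andP[i0 _].
  have i1 : 1 <= (i%:R : R) by rewrite ler1n.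
  have ip : 0 <= (i%:R / p%:R : R) by rewrite divr_ge0 // ler0n.
  rewrite add0r [h + _]addrC; have := dkernel_pair ip; set N := _ + nm _ => hN.
  have N0 : 0 <= N by rewrite addr_ge0 ?nm_ge0.
  have le1 : p%:R * (i%:R / p%:R + h) <= i%:R * (1 + t).
    by rewrite mulrDr mulrC mulfVK ?lt0r_neq0 //; nra.
  have -> : p%:R / (pi * (1 + t)) * i%:R^-1 = p%:R / (pi * (1 + t) * i%:R).
    by rewrite [in RHS]invfM mulrA.
  rewrite ler_pdivrMr; last by rewrite !mulr_gt0 //; lra.
  apply: le_trans (ler_peMr (ltW pR) hN) _.
  have -> : p%:R * (pi * (i%:R / p%:R + h) * N) = (pi * N) * (p%:R * (i%:R / p%:R + h)) by ring.
  have -> : N * (pi * (1 + t) * i%:R) = (pi * N) * (i%:R * (1 + t)) by ring.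
  by rewrite ler_wpM2l // mulr_ge0 // ltW.
have half : p%:R * ln M.+1%:R / (2 * pi * (1 + t)) = (p%:R * ln M.+1%:R / (pi * (1 + t))) / 2.
  by rewrite -[2 * pi * _]mulrA [X in _ * X = _]invfM [X in _ * X = _]mulrC mulrA.
rewrite half; move: tot; set Q := p%:R * _ / _ => tot.
have [le|gt] := leP (Q / 2) (s 0); first by exists 0.
by exists h; rewrite -/(s h); move: tot gt; lra.
Qed.
End KernelLower.

Section MaxLower.
Variables (R : realType) (p : nat) (X : 'F_p -> R[i]).
Local Notation nm := (@ComplexField.Normc.normc R).
Hypothesis p_pr : prime p.
Hypothesis p_gt2 : (2 < p)%N.
Hypothesis XM : {morph X : x y / x * y}.
Hypothesis X1 : X 1 = 1.
Hypothesis X0 : X 0 = 0.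
Hypothesis X_nontriv : exists2 u, u != 0 & X u != 1.
Variables (y : R) (y0 : 0 <= y) (y3 : y ^+ 3 = p%:R ^+ 2).
Variables (A0 L : nat) (Mx : R).
Hypothesis F_le : forall theta, nm (Fsum X A0 L theta) <= Mx.

Lemma max_lower (M : nat) (t : R) (E := 2 ^+ M * (M.+1%:R * y)) :
  (0 < L)%N -> (M < p)%N -> p%:R * (2 * L%:R)^-1 <= t ->
  (p.-1)%:R / 2 * ((p%:R * ln M.+1%:R / (2 * pi * (1 + t))) / 2) <=
  Num.sqrt p%:R * Mx * (p%:R + E) + E * (2 * L%:R + 2 * p%:R * (1 + ln p%:R)).
Proof.
move=> L0 Mp pt; have [theta hth] := sum_dkernel_ge A0 L0 M (prime_gt0 p_pr) pt.
pose K (m : 'F_p) := dkernel A0 L (theta + (m : nat)%:R / p%:R).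
pose S : seq 'F_p := [seq m%:R | m <- index_iota 1 M.+1].
have valS i : (i < p)%N -> ((i%:R : 'F_p) : nat) = i.
  by move=> ip; rewrite val_Fp_nat // modn_small.
have uS : uniq S.
  rewrite map_inj_in_uniq ?iota_uniq // => i j; rewrite !mem_index_iota => /andP[_ iM]
    /andP[_ jM].
  move/(congr1 (@nat_of_ord _)); rewrite !valS //; by [apply: leq_trans Mp|].
have SE : \sum_(m <- S) nm (K m) = \sum_(1 <= i < M.+1) nm (dkernel A0 L (theta + i%:R / p%:R)).
  rewrite big_map; apply: eq_big_nat => i /andP[_ iM]; rewrite /K valS //.
  exact: leq_trans Mp.
have [eps e1 epsge] := sign_choice S K.
have := kernel_sum_le_max p_pr p_gt2 XM X1 X0 X_nontriv y0 y3 F_le theta uS e1.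
have -> : riesz_error y S = E by rewrite /riesz_error /E size_map size_iota subn1.
move=> hm; apply: (le_trans _ (le_trans hm _)).
  rewrite ler_wpM2l ?divr_ge0 //; apply: le_trans epsge.
  by rewrite ler_wpM2r ?invr_ge0 // SE.
rewrite lerD2l ler_wpM2l ?sum_dkernel //.
by rewrite /E !mulr_ge0 ?exprn_ge0.
Qed.
End MaxLower.

Section Asymptotics.
Variable R : realType.

(** With [u = ln p] the factor [expR (2 * u / 3)] is [p ^ (2/3)]; both [2 ^ M] and
    [M + 1] are at most [expR M <= p ^ (1/8)]. *)
Lemma err_le (M : nat) (u : R) : M%:R <= u / 8 ->
  2 ^+ M * (M.+1%:R * expR (2 * u / 3)) <= expR (11 * u / 12).
Proof.
move=> Mu; have e2 : (2 : R) <= expR 1 by have := expR_ge1Dx (1 : R); lra.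
have a : 2 ^+ M <= expR (M%:R : R).
  by rewrite -[M%:R]mulr1 expRM_natl lerXn2r ?nnegrE ?expR_ge0.
have b : (M.+1%:R : R) <= expR M%:R.
  by rewrite -natr1 addrC expR_ge1Dx.
have -> : 11 * u / 12 = u / 8 + (u / 8 + 2 * u / 3) by field.
rewrite !expRD; apply: ler_pM; rewrite ?exprn_ge0 ?mulr_ge0 ?expR_ge0 //.
  by apply: le_trans a _; rewrite ler_expR.
apply: ler_wpM2r; first exact: expR_ge0.
by apply: le_trans b _; rewrite ler_expR.
Qed.

Lemma lin_err_le (a d u : R) : 0 < d -> 0 <= a -> 0 <= u -> 24 * (a + 48) / d <= u ->
  expR (11 * u / 12) * (a + 2 * u) <= d * expR u.
Proof.
move=> d0 a0 u0 hu; have e0 : 0 < expR (11 * u / 12) by apply: expR_gt0.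
have e1 := expR_ge1Dx (u / 24).
have -> : expR u = expR (11 * u / 12) * (expR (u / 24) * expR (u / 24)).
  by rewrite -!expRD; congr expR; field.
rewrite mulrCA ler_pM2l //; move: hu; rewrite ler_pdivrMr // => hu.
have h1 : d * ((1 + u / 24) * (1 + u / 24)) <= d * (expR (u / 24) * expR (u / 24)).
  by rewrite ler_pM2l // ler_pM //; lra.
apply: le_trans h1; have := ler_wpM2l u0 hu; have := mulr_ge0 a0 u0; nra.
Qed.
End Asymptotics.

(** * Dirichlet characters and attainment of the maximum *)

Section Characters.
Variables (R : realType) (p : nat) (chi : int -> R[i]).
Hypothesis p_pr : prime p.
Hypothesis chiP : dirichlet_character p chi.

Definition res_char (a : 'F_p) : R[i] := chi (a : nat)%:Z.

Lemma chi_period (n k : int) : chi (n + k * p%:Z) = chi n.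
Proof.
have [per _ _] := chiP.
have pos m (j : nat) : chi (m + j%:Z * p%:Z) = chi m.
  elim: j => [|j IH]; first by rewrite mul0r addr0.
  by rewrite -addn1 PoszD mulrDl mul1r addrA per.
case: k => k; first exact: pos.
by rewrite NegzE -[in RHS](subrK (k.+1%:Z * p%:Z) n) pos mulNr.
Qed.

Lemma chi_res n : chi n = res_char n%:~R.
Proof.
have [k hk] := Fp_intP n p_pr; move: hk; rewrite /res_char.
by set b := nat_of_ord _ => ->; rewrite chi_period.
Qed.

Lemma res_charM : {morph res_char : a b / a * b}.
Proof.
have [_ mul _] := chiP => a b.
by rewrite {2 3}/res_char -mul [RHS]chi_res -PoszM -pmulrn natrM !natr_Zp.
Qed.

Lemma coprimez_res n : coprimez n p%:Z = (n%:~R != 0 :> 'F_p).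
Proof.
have -> : (n%:~R == 0 :> 'F_p) = (p %| `|n|)%N.
  rewrite (dvdn_pcharf (pchar_Fp p_pr)); case: n => n; first by rewrite -pmulrn.
  by rewrite NegzE mulrNz oppr_eq0 -pmulrn.
by rewrite coprimezE coprime_sym prime_coprime.
Qed.

Lemma res_char_eq0 a : (res_char a == 0) = (a == 0).
Proof.
have [_ _ van] := chiP; have aE : ((a : nat)%:Z)%:~R = a by rewrite -pmulrn natr_Zp.
have := van (a : nat)%:Z; rewrite coprimez_res aE /res_char => H.
by apply: negb_inj; apply/idP/idP => /H.
Qed.

Lemma res_char1 : res_char 1 = 1.
Proof.
have n0 : res_char 1 != 0 by rewrite res_char_eq0 oner_eq0.
by apply: (mulfI n0); rewrite -res_charM !mulr1.
Qed.

Lemma res_char0 : res_char 0 = 0.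
Proof. by apply/eqP; rewrite res_char_eq0. Qed.

Lemma res_char_nontriv : chi <> principal_character R p ->
  exists2 u, u != 0 & res_char u != 1.
Proof.
move=> np; case: (pickP (fun u : 'F_p => (u != 0) && (res_char u != 1))) => [u /andP[]|triv].
  by exists u.
case: np; apply/funext => n; rewrite /principal_character chi_res coprimez_res.
case: eqP => [->|/eqP n0]; first by rewrite res_char0.
by have := triv n%:~R; rewrite n0 /= => /negbFE/eqP.
Qed.

Variables (alpha beta theta : R).
Hypothesis alpha0 : 0 <= alpha.

Lemma F_as_Fsum : F p chi alpha beta theta =
  Fsum res_char (Num.trunc (alpha * p%:R)).+1
    (Num.trunc (beta * p%:R) - Num.trunc (alpha * p%:R)) theta.
Proof.
set a := Num.trunc (alpha * p%:R); set b := Num.trunc (beta * p%:R).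
have ap0 : 0 <= alpha * p%:R by rewrite mulr_ge0.
pose r := [seq (a.+1 + j)%:Z | j <- iota 0 (b - a)].
have ur : uniq r by rewrite map_inj_uniq ?iota_uniq // => i j [] /addnI.
rewrite /F (_ : [set n : int | _]%classic = [set` r]%classic); last first.
  apply/seteqP; split => [n|n] /=.
    move=> /andP[an nb].
    have n0 : 0 < n by rewrite -(ltr0z R); apply: le_lt_trans an.
    case: n n0 an nb => // m _; rewrite -!pmulrn => am mb.
    have am' : (a < m)%N by rewrite truncn_lt_nat.
    have mb' : (m <= b)%N by rewrite truncn_ge_nat // (le_trans _ mb).
    by apply/mapP; exists (m - a.+1)%N; rewrite ?mem_iota; [lia|congr Posz; lia].
  case/mapP => j; rewrite mem_iota add0n => /andP[_ jb] ->; rewrite -!pmulrn.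
  have am : (a < a.+1 + j)%N by lia.
  have mb : (a.+1 + j <= b)%N by lia.
  rewrite truncn_lt_nat // in am; rewrite am /=.
  have b0 : 0 <= beta * p%:R.
    by case: (leP 0 (beta * p%:R)) => // h; move: mb; rewrite /b truncn_floor leNgt h.
  by rewrite truncn_ge_nat // in mb.
rewrite -fsbig_seq // big_map /Fsum -(big_mkord xpredT
  (fun j => res_char (a.+1 + j)%:R * e ((a.+1 + j)%:R * theta))).
rewrite /index_iota subn0; apply: eq_bigr => j _.
by rewrite chi_res -!pmulrn.
Qed.
End Characters.

Section Maximum.
Variables (R : realType) (p : nat) (X : 'F_p -> R[i]) (A0 L : nat).
Local Notation nm := (@ComplexField.Normc.normc R).

Lemma Fsum_period (theta : R) (k : int) : Fsum X A0 L (theta + k%:~R) = Fsum X A0 L theta.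
Proof.
apply: eq_bigr => j _; congr (_ * _); rewrite mulrDr eD.
by rewrite -[(A0 + j)%:R * k%:~R](intrM _ (A0 + j)%N k) e_int mulr1.
Qed.

(** Continuity is proved for real and imaginary parts, the complex numbers in use
    being given by coordinates. *)
Lemma e_cont (c : R) : continuous (fun t : R => complex.Re (e (c * t))) /\
  continuous (fun t : R => complex.Im (e (c * t))).
Proof.
split => t /=.
  apply: (@continuous_comp _ _ _ (fun t => 2 * pi * (c * t)) (@cos R)); last exact:
    continuous_cos.
  by apply: cvgM; [apply: cvg_cst|apply: cvgM; [apply: cvg_cst|apply: cvg_id]].
apply: (@continuous_comp _ _ _ (fun t => 2 * pi * (c * t)) (@sin R)); last exact: continuous_sin.
by apply: cvgM; [apply: cvg_cst|apply: cvgM; [apply: cvg_cst|apply: cvg_id]].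
Qed.

Lemma Fsum_ReIm_cont : continuous (fun t => complex.Re (Fsum X A0 L t)) /\
  continuous (fun t => complex.Im (Fsum X A0 L t)).
Proof.
rewrite /Fsum; elim: L => [|n [IHr IHi]].
  by split => t; under eq_fun do rewrite big_ord0; apply: cvg_cst.
have [cr ci] := e_cont (A0 + n)%:R.
set z := X (A0 + n)%:R.
have ReDM (u v w : R[i]) : complex.Re (u + v * w) =
    complex.Re u + (complex.Re v * complex.Re w - complex.Im v * complex.Im w).
  by case: u v w => [? ?] [? ?] [? ?].
have ImDM (u v w : R[i]) : complex.Im (u + v * w) =
    complex.Im u + (complex.Re v * complex.Im w + complex.Im v * complex.Re w).
  by case: u v w => [? ?] [? ?] [? ?].
have reE t : complex.Re (\sum_(j < n.+1) X (A0 + j)%:R * e ((A0 + j)%:R * t)) =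
  complex.Re (\sum_(j < n) X (A0 + j)%:R * e ((A0 + j)%:R * t)) +
  (complex.Re z * complex.Re (e ((A0 + n)%:R * t)) - complex.Im z * complex.Im (e ((A0 +
    n)%:R * t))).
  by rewrite big_ord_recr ReDM.
have imE t : complex.Im (\sum_(j < n.+1) X (A0 + j)%:R * e ((A0 + j)%:R * t)) =
  complex.Im (\sum_(j < n) X (A0 + j)%:R * e ((A0 + j)%:R * t)) +
  (complex.Re z * complex.Im (e ((A0 + n)%:R * t)) + complex.Im z * complex.Re (e ((A0 +
    n)%:R * t))).
  by rewrite big_ord_recr ImDM.
split => t.
  rewrite (funext reE); apply: cvgD; first exact: IHr.
  by apply: cvgB; apply: cvgM; [apply: cvg_cst|apply: cr|apply: cvg_cst|apply: ci].
rewrite (funext imE); apply: cvgD; first exact: IHi.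
by apply: cvgD; apply: cvgM; [apply: cvg_cst|apply: ci|apply: cvg_cst|apply: cr].
Qed.

Lemma nm_Fsum_cont : continuous (fun t => nm (Fsum X A0 L t)).
Proof.
have [cr ci] := Fsum_ReIm_cont => t.
have E s : nm (Fsum X A0 L s) =
  Num.sqrt (complex.Re (Fsum X A0 L s) * complex.Re (Fsum X A0 L s) +
    complex.Im (Fsum X A0 L s) * complex.Im (Fsum X A0 L s)).
  by case: (Fsum X A0 L s).
rewrite (funext E).
apply: (@continuous_comp _ _ _ (fun s => complex.Re (Fsum X A0 L s) * complex.Re (Fsum X A0 L s) +
    complex.Im (Fsum X A0 L s) * complex.Im (Fsum X A0 L s))
   (@Num.sqrt R)); last exact: sqrt_continuous.
by apply: cvgD; apply: cvgM; [apply: cr|apply: cr|apply: ci|apply: ci].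
Qed.

(** Attained on the compact interval by continuity, then moved away from the
    endpoint [1] by periodicity. *)
Lemma Fsum_max : exists2 t0 : R, 0 <= t0 < 1 &
  forall t, nm (Fsum X A0 L t) <= nm (Fsum X A0 L t0).
Proof.
have cont : {within `[0, 1], continuous (fun t : R => nm (Fsum X A0 L t))}%classic.
  by apply: continuous_subspaceT => t; apply: nm_Fsum_cont.
have [c] := EVT_max ler01 cont; rewrite in_itv /= => /andP[c0 c1] cmax.
have red t : exists2 s : R, 0 <= s < 1 & Fsum X A0 L t = Fsum X A0 L s.
  exists (t - (Num.floor t)%:~R); last by rewrite -[RHS](Fsum_period _ (Num.floor t)) subrK.
  by rewrite subr_ge0 ge_floor /= ltrBlDl; have := floorD1_gt t; rewrite intrD.
have [s s01 sE] := red c; exists s => // t; rewrite -sE.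
have [s' /andP[s'0 s'1] ->] := red t.
by apply: cmax; rewrite in_itv /= s'0 ltW.
Qed.
End Maximum.

(** * Conclusion *)

Section Final.
Variables (R : realType).
Local Notation nm := (@ComplexField.Normc.normc R).

Lemma length_bounds (a b : R) (p : nat) (l := b - a)
    (L := (Num.trunc (b * p%:R) - Num.trunc (a * p%:R))%N) :
  0 <= a -> a < b -> 2 / l <= p%:R -> (0 < p)%N ->
  [/\ (0 < L)%N, l * p%:R / 2 <= L%:R & L%:R <= (l + 1) * p%:R].
Proof.
move=> a0 ab pl p0; have l0 : 0 < l by rewrite subr_gt0.
have p1 : 1 <= (p%:R : R) by rewrite ler1n.
have b0 : 0 <= b by lra.
have ap0 : 0 <= a * p%:R by rewrite mulr_ge0.
have bp0 : 0 <= b * p%:R by rewrite mulr_ge0.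
have /andP[a1 a2] := truncn_itv ap0; have /andP[b1 b2] := truncn_itv bp0.
have le : (Num.trunc (a * p%:R) <= Num.trunc (b * p%:R))%N.
  by apply: le_truncn; rewrite ler_wpM2r // ltW.
have LE : L%:R = (Num.trunc (b * p%:R))%:R - (Num.trunc (a * p%:R))%:R :> R by rewrite natrB.
rewrite -natr1 in a2; rewrite -natr1 in b2; rewrite ler_pdivrMr // in pl.
have lE : l * p%:R = b * p%:R - a * p%:R by rewrite mulrBl.
have h1 : l * p%:R / 2 <= L%:R by rewrite LE; lra.
split => //; last by rewrite LE mulrDl mul1r lE; lra.
by rewrite -(ltr0n R); apply: lt_le_trans h1; rewrite !mulr_gt0 ?ltr0n.
Qed.

Lemma upper_final (p L : nat) (l Mx : R) : (0 < p)%N -> 0 <= l -> 1 <= ln (p%:R : R) ->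
  L%:R <= (l + 1) * p%:R ->
  Num.sqrt p%:R * Mx <= 2 * L%:R + 2 * p%:R * (1 + ln p%:R) ->
  Mx <= (2 * l + 6) * Num.sqrt p%:R * ln p%:R.
Proof.
move=> p0 l0 u1 hL hM; have pR : 0 < (p%:R : R) by rewrite ltr0n.
have s0 : 0 < Num.sqrt (p%:R : R) by rewrite sqrtr_gt0.
have ss : Num.sqrt (p%:R : R) * Num.sqrt p%:R = p%:R by rewrite -expr2 sqr_sqrtr ?ltW.
rewrite -(ler_pM2l s0); apply: le_trans hM _.
have -> : Num.sqrt p%:R * ((2 * l + 6) * Num.sqrt p%:R * ln p%:R) =
   (Num.sqrt p%:R * Num.sqrt p%:R) * ((2 * l + 6) * ln p%:R) by ring.
rewrite ss.
apply: (@le_trans _ _ (p%:R * (2 * l + 2 + 2 * (1 + ln p%:R)))).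
  by move: hL; lra.
by apply: (ler_wpM2l (ltW pR)); have := ler_wpM2l l0 u1; lra.
Qed.

(** In [max_lower] with [M] about [u / 8], where [u = ln p], the main term is at least
    [c2 * p ^ 2 * ln (M + 1)] and the error term is at most half of it, while
    [ln u <= 2 * ln (M + 1)]. *)
Lemma lower_final (p L : nat) (X : 'F_p -> R[i]) (A0 : nat) (l Mx c2 : R) :
  prime p -> (2 < p)%N -> {morph X : x y / x * y} -> X 1 = 1 -> X 0 = 0 ->
  (exists2 u, u != 0 & X u != 1) -> 0 < l ->
  c2 = (16 * pi * (1 + l^-1))^-1 ->
  64 <= ln (p%:R : R) -> 2 <= ln (ln (p%:R : R)) ->
  24 * ((2 * l + 4) + 48) / (c2 / 2) <= ln p%:R ->
  (0 < L)%N -> l * p%:R / 2 <= L%:R -> L%:R <= (l + 1) * p%:R ->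
  (forall theta, nm (Fsum X A0 L theta) <= Mx) ->
  c2 / 8 * Num.sqrt p%:R * ln (ln p%:R) <= Mx.
Proof.
move=> p_pr p2 XM X1 X0 Xn l0 c2E u64 lnu hu L0 hL1 hL2 FM.
have p2p : (p <= 2 * p.-1)%N by clear -p2; lia.
have pR : 0 < (p%:R : R) by rewrite ltr0n prime_gt0.
have LR : 0 < (L%:R : R) by rewrite ltr0n.
set u := ln (p%:R : R) in u64 lnu hu *.
have pE : p%:R = expR u by rewrite lnK.
have li : 0 < l^-1 by rewrite invr_gt0.
have pi0 := pi_gt0 R.
have D0 : 0 < 16 * pi * (1 + l^-1) by rewrite !mulr_gt0 // addr_gt0.
have c20 : 0 < c2 by rewrite c2E invr_gt0.
pose M := Num.trunc (u / 8).
have u80 : 0 <= u / 8 by lra.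
have /andP[M1 M2] := truncn_itv u80; rewrite -/M in M1 M2.
have Mp : (M < p)%N.
  rewrite -(ltr_nat R); apply: le_lt_trans M1 _; apply: (@lt_trans _ _ u).
    by lra.
  exact: ln_sublinear.
pose y := expR (2 * u / 3).
have y0 : 0 <= y by apply: expR_ge0.
have y3 : y ^+ 3 = p%:R ^+ 2.
  by rewrite pE -!expRM_natl; congr expR; field.
have pt : p%:R * (2 * L%:R)^-1 <= l^-1.
  rewrite ler_pdivrMr ?mulr_gt0 // -(ler_pM2l l0) mulrA mulfV ?lt0r_neq0 // mul1r; lra.
have := max_lower p_pr p2 XM X1 X0 Xn y0 y3 FM L0 Mp pt.
set E := 2 ^+ M * _; set ell := ln M.+1%:R => hmain.
have EE : E <= expR (11 * u / 12) by apply: err_le.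
have E0 : 0 <= E by rewrite /E !mulr_ge0 ?exprn_ge0.
have Mx0 : 0 <= Mx by apply: le_trans (nm_ge0 _) (FM 0).
have s0 : 0 < Num.sqrt (p%:R : R) by rewrite sqrtr_gt0.
have ss : Num.sqrt (p%:R : R) * Num.sqrt p%:R = p%:R by rewrite -expr2 sqr_sqrtr ?ltW.
have ellge : ln u <= 2 * ell.
  have -> : 2 * ell = ln (M.+1%:R ^+ 2) by rewrite lnXn ?ltr0n // mulr_natl.
  rewrite ler_ln ?posrE ?exprn_gt0 ?ltr0n //; last by lra.
  by rewrite expr2; nra.
have ell1 : 1 <= ell by lra.
have Ep : E <= p%:R.
  by apply: le_trans EE _; rewrite pE ler_expR; lra.
have Eerr : E * (2 * l + 4 + 2 * u) <= c2 / 2 * p%:R.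
  apply: (@le_trans _ _ (expR (11 * u / 12) * (2 * l + 4 + 2 * u))).
    by rewrite ler_wpM2r //; lra.
  by rewrite pE; apply: lin_err_le; lra.
have lhs : c2 * (p%:R * p%:R * ell) <= (p.-1)%:R / 2 * ((p%:R * ell / (2 * pi * (1 + l^-1))) / 2).
  have -> : (p.-1)%:R / 2 * ((p%:R * ell / (2 * pi * (1 + l^-1))) / 2) =
     c2 * (p%:R * ell * (2 * (p.-1)%:R)) :> R.
    have q0 : 1 + l^-1 != 0 by apply: lt0r_neq0; apply: addr_gt0.
    have pin : (pi : R) != 0 by apply: lt0r_neq0.
    rewrite c2E; move: (1 + l^-1) (pi : R) q0 pin => q P q0 Pn; field.
    by rewrite q0 Pn.
  have hp : (p%:R : R) <= 2 * (p.-1)%:R by rewrite -natrM ler_nat.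
  have pe0 : 0 <= p%:R * ell by rewrite mulr_ge0 // (le_trans _ ell1).
  by rewrite ler_pM2l // mulrAC; apply: ler_wpM2l.
have rhs : Num.sqrt p%:R * Mx * (p%:R + E) + E * (2 * L%:R + 2 * p%:R * (1 + u)) <=
   2 * (Num.sqrt p%:R * Mx * p%:R) + c2 / 2 * p%:R * p%:R.
  apply: lerD.
    have := ler_wpM2l (mulr_ge0 (ltW s0) Mx0) Ep; lra.
  apply: (@le_trans _ _ (E * (2 * l + 4 + 2 * u) * p%:R)); last by rewrite ler_wpM2r // ltW.
  rewrite -[leRHS]mulrA; apply: ler_wpM2l => //; clear -hL2; lra.
have key : c2 * (p%:R * p%:R * ell) <= 2 * (Num.sqrt p%:R * Mx * p%:R) + c2 / 2 * p%:R * p%:R.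
  exact: le_trans lhs (le_trans hmain rhs).
have key2 : c2 * (p%:R * p%:R * ell) / 2 <= 2 * (Num.sqrt p%:R * Mx * p%:R).
  have : c2 * (p%:R * p%:R) * 1 <= c2 * (p%:R * p%:R) * ell.
    by rewrite ler_wpM2l // !mulr_ge0 // ltW.
  by move: key; lra.
have key3 : c2 / 4 * ell * (Num.sqrt p%:R * Num.sqrt p%:R) <= Num.sqrt p%:R * Mx.
  rewrite ss -(ler_pM2r pR); move: key2; lra.
have key4 : c2 / 4 * ell * Num.sqrt p%:R <= Mx.
  by rewrite -(ler_pM2l s0) mulrCA.
apply: le_trans key4; rewrite mulrAC; apply: (ler_wpM2r (ltW s0)).
have : c2 * ln u <= c2 * (2 * ell) by rewrite ler_wpM2l // ltW.
lra.
Qed.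
End Final.

Local Open Scope classical_set_scope.

Theorem theorem1p1 (R : realType) (alpha beta : R) :
  0 <= alpha -> alpha < beta ->
  exists (p0 : nat) (c C : R), [/\ 0 < c, 0 < C &
    forall (p : nat) (chi : int -> R[i]),
      prime p -> (p0 <= p)%N ->
      dirichlet_character p chi -> chi <> principal_character R p ->
      exists M : R,
        [/\ is_max [set ComplexField.Normc.normc (F p chi alpha beta theta)
                     | theta in [set theta : R | 0 <= theta < 1]] M,
            c * Num.sqrt p%:R * ln (ln p%:R) <= M
          & M <= C * Num.sqrt p%:R * ln p%:R]].
Proof.
move=> a0 ab; pose l := beta - alpha; have l0 : 0 < l by rewrite subr_gt0.
have pi0 := pi_gt0 R; have li : 0 < l^-1 by rewrite invr_gt0.
pose c2 : R := (16 * pi * (1 + l^-1))^-1.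
have c20 : 0 < c2 by rewrite invr_gt0 !mulr_gt0 // addr_gt0.
pose t1 := 24 * ((2 * l + 4) + 48) / (c2 / 2).
have t10 : 0 <= t1 by rewrite /t1 !divr_ge0 ?mulr_ge0 //; lra.
(* Each summand is a lower bound required of [ln p]: [expR 2] for
   [ln (ln p) >= 2], [64] for [ln p <= (M + 1) ^ 2], [t1] for the error term,
   [2 / l] for the number of terms of the sum. *)
pose u0 := expR 2 + 64 + t1 + 2 / l.
have e2 : 0 < expR (2 : R) by apply: expR_gt0.
have l20 : 0 < 2 / l by rewrite divr_gt0.
exists (Num.trunc (expR u0)).+1, (c2 / 8), (2 * l + 6); split; [by lra | by lra |].
move=> p chi p_pr p0p chiP np.
have pu0 : expR u0 < p%:R.
  by apply: lt_le_trans (truncnS_gt _) _; rewrite ler_nat.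
have pR : 0 < (p%:R : R) by rewrite ltr0n prime_gt0.
have uge : u0 <= ln p%:R by rewrite -[u0]expRK ler_ln ?posrE ?expR_gt0 // ltW.
have ulep : ln (p%:R : R) < p%:R by apply: ln_sublinear.
have p2 : (2 < p)%N by rewrite -(ltr_nat R); rewrite /u0 in uge; lra.
have pl : 2 / l <= p%:R by rewrite /u0 in uge; lra.
have [L0 hL1 hL2] := length_bounds a0 ab pl (prime_gt0 p_pr).
pose X := res_char (p := p) chi.
have XM : {morph X : x y / x * y} := res_charM p_pr chiP.
have X1 : X 1 = 1 := res_char1 p_pr chiP.
have X0 : X 0 = 0 := res_char0 p_pr chiP.
have Xn : exists2 u, u != 0 & X u != 1 := res_char_nontriv p_pr chiP np.
have FE theta := F_as_Fsum p_pr chiP beta theta a0.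
rewrite -/X in FE.
set A0 := _.+1 in FE; set L := (_ - _)%N in FE L0 hL1 hL2.
have [t0 t0I tmax] := Fsum_max X A0 L.
exists (ComplexField.Normc.normc (Fsum X A0 L t0)); split.
- split; first by exists t0 => //; rewrite FE.
  by move=> _ [t _ <-]; rewrite FE.
- apply: (@lower_final R p L X A0 l _ c2 p_pr p2 XM X1 X0 Xn l0 (erefl _)) => //.
  + by rewrite /u0 in uge; lra.
  + by rewrite -[2]expRK ler_ln ?posrE ?expR_gt0 //; rewrite /u0 in uge; lra.
  + by rewrite -/t1; rewrite /u0 in uge; lra.
- apply: (@upper_final R p L l) => //.
  + exact: prime_gt0.
  + exact: ltW.
  + by rewrite /u0 in uge; lra.
  + exact: (nm_Fsum_le p_pr p2 XM X1 X0 Xn).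
Qed.
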